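(* Let $S=(S_t)_{t\ge0}$ be a subordinator with no drift and infinite Lévy measure $\Pi$. Let $f:\mathbb{R}_+\to\mathbb{R}$ be a bounded, non-decreasing, right-continuous function. Then $f$ belongs to the domain $\mathcal{D}_e$ of the extended generator of $S$, and $$G_ef(x)=\int_{(0,\infty)}\bigl(f(x+y)-f(x)\bigr)\,\Pi(\mathrm{d}y),\qquad x\ge0.$$
   Context: $\mathbb{R}_+=[0,\infty)$. $S$ is a process with values in $\mathbb{R}_+$, $S_0=0$, with independent and stationary increments, whose sample paths are right-continuous, strictly increasing and have no continuous component; thus $S_t=\sum_{0<s\le t}\Delta S_s$ with $\Delta S_s=S_s-S_{s-}$, and the jump process $\Delta S$ is a Poisson point process with intensity $\Pi$ (the Lévy measure of $S$), where $\Pi((0,\infty))=\infty$ and $\int_{(0,\infty)}(1\wedge y)\,\Pi(\mathrm{d}y)<\infty$. Martingales are with respect to the natural filtration of $S$, augmented to satisfy the usual conditions. A measurable function $h:\mathbb{R}_+\to\mathbb{R}$ belongs to the domain $\mathcal{D}_e$ of the extended generator of $S$ if there exists a measurable function $b$ on $\mathbb{R}_+$ such that for every $x\ge0$ and $t\ge0$, $\int_0^t|b(x+S_s)|\,\mathrm{d}s<\infty$ a.s., and for every $x\geq 0$ the process $$h(x+S_t)-\int_0^t b(x+S_s)\,\mathrm{d}s,\qquad t\ge0,$$ is a martingale. One then writes $G_eh=b$ (a slight abuse of notation, since $b$ is not unique): the assertion $G_eh=b$ means that, for this $b$, $\int_0^t|b(x+S_s)|\,\mathrm{d}s<\infty$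 a.s. for every $x\ge0$ and $t\ge0$, and the process $h(x+S_t)-\int_0^t b(x+S_s)\,\mathrm{d}s$, $t\ge0$, is a martingale for every $x\ge0$. Here $b$ is allowed to take values in $[-\infty,\infty]$; the integral defining $G_ef(x)$ in the claim is well-defined in $[0,\infty]$ and possibly infinite. *)

(* Defs.v *)
From HB Require Import structures.
From mathcomp Require Import all_boot all_order all_algebra.
From mathcomp Require Import all_classical all_reals all_analysis.
From mathcomp Require Import measurable_realfun.

Set Implicit Arguments.
Unset Strict Implicit.
Unset Printing Implicit Defensive.

Import Order.TTheory GRing.Theory Num.Theory.
Import numFieldNormedType.Exports.

Local Open Scope classical_set_scope.
Local Open Scope ring_scope.

(* Processes are indexed by R, but only their values at times t >= 0 are
   constrained and used. Likewise a function on R_+ is a function on R of which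
   only the values on `[0, +oo[ are constrained and used. *)

Section processes.
Context {d : measure_display} {T : measurableType d} {R : realType}.
Implicit Types (P : probability T R) (S X : R -> T -> R).
Implicit Types (G : set (set T)) (F : R -> set (set T)).

Definition natural_filtration S (t : R) : set (set T) :=
  <<s [set A | exists (u : R) (B : set R),
         [/\ 0 <= u <= t, measurable B & A = S u @^-1` B]] >>.

Definition augmented_filtration P S (t : R) : set (set T) :=
  \bigcap_(u in `]t, +oo[)
    <<s natural_filtration S u `|` [set A | P.-negligible A] >>.

Definition measurable_wrt G (Y : T -> R) :=
  forall B : set R, measurable B -> G (Y @^-1` B).

(* Y is a version of the conditional expectation of X given the sigma-algebra G.
   P is not assumed complete, so G (which may contain all P-negligible sets)
   need not consist of measurable sets; the integrals are tested on those
   members of G that are. If P is complete, the members of the augmented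
   filtration are all measurable; in general each of them differs by a
   negligible set from a measurable member. *)
Definition is_cond_exp P G (X Y : T -> R) :=
  [/\ measurable_wrt G Y,
      P.-integrable setT (EFin \o Y) &
      forall A, measurable A -> G A ->
        (\int[P]_(w in A) (Y w)%:E = \int[P]_(w in A) (X w)%:E)%E].

Definition martingale P F X :=
  [/\ forall t : R, 0 <= t -> measurable_wrt (F t) (X t),
      forall t : R, 0 <= t -> P.-integrable setT (EFin \o X t) &
      forall s t : R, 0 <= s -> s <= t -> is_cond_exp P (F s) (X t) (X s)].

(* N is a Poisson random measure on D with intensity mu. That N w B = +oo almost
   surely when mu B = +oo is a consequence if mu is sigma-finite. *)
Definition poisson_random_measure P d' (E : measurableType d') (D : set E)
    (mu : set E -> \bar R) (N : T -> set E -> \bar R) :=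
  [/\ forall B, measurable B -> B `<=` D -> measurable_fun setT (N ^~ B),
      forall B (k : nat), measurable B -> B `<=` D -> (mu B < +oo)%E ->
        P [set w | N w B = k%:R%:E] =
        (expR (- fine (mu B)) * fine (mu B) ^+ k / k`!%:R)%:E &
      forall n (B : 'I_n -> set E) (C : 'I_n -> set (\bar R)),
        (forall i, measurable (B i)) -> (forall i, B i `<=` D) ->
        trivIset setT B -> (forall i, measurable (C i)) ->
        P [set w | forall i, C i (N w (B i))] =
        (\prod_(i < n) P [set w | C i (N w (B i))])%E].

Definition jump S (s : R) (w : T) : R := S s w - lim (S u w @[u --> s^'-]).

Definition jump_count S (w : T) (B : set (R * R)) : \bar R :=
  counting [set s | [/\ 0 < s, 0 < jump S s w & B (s, jump S s w)]].

(* A measure on ]0, +oo[ is encoded as a measure on R that vanishes on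
   `]-oo, 0]. Sigma-finiteness, needed to form the product with the Lebesgue
   measure, loses nothing: it follows from the integrability of min(1, y). *)
Definition levy_measure (Pi : {sigma_finite_measure set R -> \bar R}) :=
  Pi `]-oo, 0]%classic = 0%E /\
  (\int[Pi]_(y in `]0%R, +oo[) (Num.min 1%R y)%:E < +oo)%E.

(* A strictly increasing subordinator without drift and with Levy measure Pi. *)
Record driftless_subordinator P S
    (Pi : {sigma_finite_measure set R -> \bar R}) : Prop := {
  sub_levy : levy_measure Pi;
  sub_meas : forall t : R, 0 <= t -> measurable_fun setT (S t);
  sub_ge0 : forall (t : R) w, 0 <= t -> 0 <= S t w;
  sub_0 : forall w, S 0 w = 0;
  sub_indep : forall (s t : R) (A : set T) (B : set R), 0 <= s -> s <= t ->
    natural_filtration S s A -> measurable B ->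
    (P (A `&` [set w | B (S t w - S s w)%R]) =
     P A * P [set w | B (S t w - S s w)%R])%E;
  sub_stat : forall (s t : R) (B : set R), 0 <= s -> s <= t -> measurable B ->
    P [set w | B (S t w - S s w)] = P [set w | B (S (t - s) w)];
  sub_rcont : forall (t : R) w, 0 <= t -> S u w @[u --> t^'+] --> S t w;
  sub_incr : forall (s t : R) w, 0 <= s -> s < t -> S s w < S t w;
  sub_jumps : forall (t : R) w, 0 <= t ->
    (S t w)%:E = \esum_(s in `]0, t]) (jump S s w)%:E;
  sub_poisson : poisson_random_measure P
    [set z : R * R | 0 < z.1 /\ 0 < z.2] (lebesgue_measure \x Pi)%E (jump_count S)
}.

(* The assertion G_e h = b. The function b may take infinite values; where the
   integral of b along the path is infinite, which is a null event, "fine"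
   replaces it by 0. *)
Definition extended_generator P S (h : R -> R) (b : R -> \bar R) :=
  [/\ measurable_fun `[(0 : R), +oo[ h,
      measurable_fun `[(0 : R), +oo[ b,
      forall x t : R, 0 <= x -> 0 <= t ->
        {ae P, forall w,
          (\int[lebesgue_measure]_(s in `[0%R, t]) `|b (x + S s w)%R| < +oo)%E} &
      forall x : R, 0 <= x ->
        martingale P (augmented_filtration P S)
          (fun t w => h (x + S t w) -
             fine (\int[lebesgue_measure]_(s in `[0%R, t]) b (x + S s w)%R)%E)].

Definition extended_domain P S (h : R -> R) :=
  exists b, extended_generator P S h b.

End processes.

(* Main.v *)
Require Import Defs.
From HB Require Import structures.
From mathcomp Require Import all_boot all_order all_algebra finmap.
From mathcomp Require Import all_classical all_reals all_analysis.
From mathcomp Require Import measurable_realfun.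
From mathcomp Require Import lra ring.

Import Order.TTheory GRing.Theory Num.Theory.
Import numFieldNormedType.Exports.

(** Why the theorem holds.

Write [g] for the extension of [f] to the line that is constant on the
negatives.  For a level [c], right-continuity and monotonicity make
[{g >= c}] a half-line [r, +oo[, and the increment
[g (x + S_t) - g (x + S_s)] is the length of the set of levels [c] that
[g (x + S)] passes between [s] and [t].  By Tonelli's theorem in [c]
([increment_formula]) it is therefore enough to treat the passage of a single
level: for [A] in the past of [s],
<<
  P (A, S_s < r <= S_t) = E (1_A \int_s^t 1{S_v < r} Pi [r - S_v, +oo[ dv),
>>
which is [level_formula].  As [f] is bounded, both sides of the resulting
formula for increments are finite, so the compensator is integrable and the
compensated process has increments of mean zero over every event of the past.
Right-continuity in time carries this over to the augmented filtration
([integral_compensated_le], [compensated_martingale]).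

The formula for a level is obtained in two stages.

Leaps.  Fix [z < r] and consider the paths that pass from below [z] to [r] or
beyond without visiting [z, r[.  Such a leap at a time [v] is seen by exactly
the increments of duration [h] that start in [v - h, v[, so the number of
leaps in ]s, t] (at most one, by monotonicity) is the limit of [1/h] times the
measure of the starting times whose increment straddles [z, r[
([straddle_jump], [straddle_nojump]).  Taking expectations, the Markov property
turns the integrand into [P (S_h >= r - S_v) / h], and [P (S_h >= a) / h] tends
to the [Pi]-mass of [a, +oo[ along [h = 2^-m] ([rate_cvg]).  The latter follows from the
Poisson property: that all increments over a mesh of [0, 1] stay below [a] has
probability [(1 - P (S_h >= a))^(1/h)], and in the limit it means that no
jump of ]0, 1] reaches [a], an event of probability [exp (- Pi [a, +oo[)].
The gap [z < r] keeps the rates bounded, so that dominated convergence applies;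
this gives [leap_formula].

Creeping.  Letting [z] increase to [r] gives the formula for the passage of [r],
except on the event [creep r] that [r] is approached continuously from below.
So the probability [p r] of [creep r] must vanish: [creep_prob0], a theorem of
Kesten.  As [Pi] is not zero, [S] tends to infinity and passes every level.  After
creeping up to [x] the process a.s. does not leap from [x] ([creep_hit_right]);
restarting it there gives
[p (x + y) <= p x * p y + 1 - p x] ([creep_prob_step]).  If [p r > 0] then [p] takes
values close to [1] at arbitrarily small arguments ([creep_prob_near1]), since
the conditional probability of creeping up to [r], given a visit to [z, r[,
tends to [1] as [z] increases to [r].  The inequality then makes [p] stay above
[3/4] along the descending progression [x - j h], for a fixed [x] with [p x]
near [1] and arbitrarily small [h] with [p h] near [1]; by semicontinuity [p >= 3/4]
on the whole of ]0, x[.  But the jumps of a path fill [0, S_t] up to a Lebesgue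
null set, and no level inside a jump is crept up to ([creeps_null]), so that [p]
is small somewhere in ]0, x[ ([creep_prob_small]): a contradiction. *)

Set Implicit Arguments.
Unset Strict Implicit.
Unset Printing Implicit Defensive.

Local Open Scope classical_set_scope.
Local Open Scope ring_scope.

(** * Increasing right-continuous paths *)

Section paths.
Context {R : realType}.
Implicit Types (X : R -> R) (s t u z r h : R).

Definition dyadic (m k : nat) : R := k%:R / 2 ^+ m.

Definition mesh (m : nat) : R := (2 ^+ m)^-1.

Definition hits X z r := exists2 u, 0 <= u & z <= X u < r.

(** Since the path is strictly increasing, this says that [r] is its left limit at the time
    when it passes [r]. *)
Definition creeps X r := forall z, z < r -> hits X z r.

Record regular_path X : Prop := {
  path_0 : X 0 = 0;
  path_incr : forall s t, 0 <= s -> s < t -> X s < X t;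
  path_rcont : forall t, 0 <= t -> X u @[u --> t^'+] --> X t }.

Lemma mesh_gt0 m : 0 < mesh m.
Proof. by rewrite invr_gt0 exprn_gt0. Qed.

Lemma mesh_cvg0 : mesh m @[m --> \oo] --> 0.
Proof.
have -> : mesh = geometric 1 2^-1 by apply/funext=> m /=; rewrite mul1r exprVn.
by apply: cvg_geometric; rewrite ger0_norm ?invr_ge0// invf_lt1 ?ltr1n.
Qed.

Lemma mesh_lt e : 0 < e -> \forall m \near \oo, mesh m < e.
Proof. by move=> e0; apply: (cvgr_lt _ mesh_cvg0 _ e0). Qed.

Lemma dyadicS m k : dyadic m k.+1 = dyadic m k + mesh m.
Proof. by rewrite /dyadic -addn1 natrD mulrDl mul1r. Qed.

Lemma dyadic0 m : dyadic m 0 = 0. Proof. by rewrite /dyadic mul0r. Qed.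

Lemma dyadic_ge0 m k : 0 <= dyadic m k.
Proof. by rewrite divr_ge0 ?exprn_ge0. Qed.

Lemma dyadic_le m j k : (j <= k)%N -> dyadic m j <= dyadic m k :> R.
Proof. by move=> jk; rewrite ler_pM2r ?invr_gt0 ?exprn_gt0// ler_nat. Qed.

Lemma dyadic_refine m k : dyadic m.+1 k.*2 = dyadic m k.
Proof.
by rewrite /dyadic -muln2 natrM exprSr -mulf_div divff ?mulr1// pnatr_eq0.
Qed.

Lemma dyadic_right u e : 0 <= u -> 0 < e ->
  \forall m \near \oo, exists k, u < dyadic m k <= u + e.
Proof.
move=> u0 e0; near=> m.
have m0 : 0 < 2 ^+ m :> R by rewrite exprn_gt0.
have /andP[k1 k2] : (Num.truncn (u * 2 ^+ m))%:R <= u * 2 ^+ m <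
    (Num.truncn (u * 2 ^+ m)).+1%:R.
  by apply: truncn_itv; rewrite mulr_ge0// ltW.
exists (Num.truncn (u * 2 ^+ m)).+1; rewrite {1}/dyadic ltr_pdivlMr// k2/=.
rewrite dyadicS; apply: lerD; first by rewrite /dyadic ler_pdivrMr.
by apply: ltW; near: m; exact: mesh_lt.
Unshelve. all: by end_near. Qed.

Section regular.
Variables (X : R -> R) (rX : regular_path X).

Lemma path_homo s t : 0 <= s -> s <= t -> X s <= X t.
Proof.
move=> s0; rewrite le_eqVlt => /predU1P[->//|st].
exact/ltW/(path_incr rX).
Qed.

Lemma path_ltW s t : 0 <= t -> X s < X t -> s < t.
Proof. by move=> t0; apply: contraTT; rewrite -!leNgt => /path_homo; apply. Qed.

Lemma path_stays_below t r : 0 <= t -> X t < r ->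
  exists2 e, 0 < e & X (t + e) < r.
Proof.
move=> t0 Xtr; have Xr : \forall u \near t^'+, X u < r.
  exact: cvgr_lt _ (path_rcont rX t0) _ Xtr.
near t^'+ => u; exists (u - t).
  by rewrite subr_gt0; near: u; exact: nbhs_right_gt.
by rewrite subrKC; near: u.
Unshelve. all: by end_near. Qed.

Lemma hits_dyadic z r : hits X z r ->
  \forall m \near \oo, exists k, z <= X (dyadic m k) < r.
Proof.
move=> [u u0 /andP[zX Xr]]; have [e e0 Xer] := path_stays_below u0 Xr.
near=> m; have [k /andP[uk ke]] : exists k, u < dyadic m k <= u + e.
  by near: m; exact: dyadic_right.
exists k; rewrite (le_trans zX) ?path_homo// 1?ltW//=.
by rewrite (le_lt_trans _ Xer)// path_homo// dyadic_ge0.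
Unshelve. all: by end_near. Qed.

Section straddle.
Variables (s t z r : R) (s0 : 0 <= s) (zr : z < r).

Definition straddle h := [set v | s < v <= t /\ X v < z /\ r <= X (v + h)].

Lemma measurable_straddle h : 0 <= h -> measurable (straddle h).
Proof.
move=> h0; apply: is_interval_measurable => v1 v2 /=.
move=> [/andP[sv1 v1t] [Xv1 rX1]] [/andP[sv2 v2t] [Xv2 rX2]] v /andP[v1v vv2].
have v0 : 0 <= v by rewrite (le_trans _ v1v)// ltW// (le_lt_trans s0).
split; first by rewrite (lt_le_trans sv1)//= (le_trans vv2).
split; first by rewrite (le_lt_trans _ Xv2)// path_homo.
rewrite (le_trans rX1)// path_homo ?lerD2r//.
by rewrite addr_ge0// (le_trans s0)// ltW.
Qed.

(** Straddling increments that start at [v1 <= v2] with [v2 - v1 > h] would be disjoint,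
    and the path would have reached [r] before [v2] although [X v2 < z < r]. *)
Lemma straddle_le h : 0 < h -> (lebesgue_measure (straddle h) <= h%:E)%E.
Proof.
move=> h0; have mB := measurable_straddle (ltW h0).
have [->|/set0P[v0 Bv0]] := eqVneq (straddle h) set0.
  by rewrite measure0 lee_fin ltW.
have lbB : has_lbound (straddle h).
  by exists s => v [/andP[/ltW]].
have hasB : has_inf (straddle h) by split; [exists v0|].
pose a := inf (straddle h).
have BI : straddle h `<=` `[a, a + h].
  move=> v Bv /=; rewrite in_itv/= ge_inf//= leNgt; apply/negP => ahv.
  have [|v1 Bv1] := @inf_adherent _ (straddle h) (v - h - a) _ hasB.
    by rewrite subr_gt0 ltrBrDr.
  rewrite -/a subrKC ltrBrDr => v1v.
  case: Bv Bv1 => [/andP[sv vt] [Xv rXv]] [/andP[sv1 v1t] [Xv1 rXv1]].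
  have : X (v1 + h) <= X v.
    by rewrite path_homo//; [rewrite addr_ge0 ?(ltW h0)// (le_trans s0)// ltW|exact: ltW].
  by move=> /(le_trans rXv1) /le_lt_trans/(_ Xv)/lt_trans/(_ zr); rewrite ltxx.
apply: (@le_trans _ _ (lebesgue_measure `[a, a + h])).
  by apply: le_measure => //; rewrite inE//; exact: measurable_itv.
by rewrite lebesgue_measure_itv/= lte_fin ltrDl h0 -EFinD addrC addKr.
Qed.

(** If the leap happens at time [v], the increments that see it start in [v - h, v[,
    an interval of length [h]; [h] must be small for it to lie in ]s, t]. *)
Lemma straddle_jump : s <= t -> X s < z -> r <= X t -> ~ hits X z r ->
  \forall m \near \oo, lebesgue_measure (straddle (mesh m)) = (mesh m)%:E.
Proof.
move=> st Xsz rXt Xzr.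
(* [sup A] is the time of the leap. *)
pose A := [set v | s <= v /\ X v < z].
have As : A s by split.
have ubA : ubound A t.
  move=> v [sv Xvz]; apply/ltW/path_ltW; first exact: le_trans st.
  by rewrite (lt_le_trans Xvz)// (le_trans _ rXt)// ltW.
have supA : has_sup A by split; [exists s|exists t].
have sA : s < sup A.
  have [e e0 Xse] := path_stays_below s0 Xsz.
  rewrite (@lt_le_trans _ _ (s + e)) ?ltrDl//.
  by apply: ub_le_sup => //; [exists t|split => //; rewrite lerDl ltW].
near=> m; have h0 : 0 < mesh m := mesh_gt0 m.
have hA : mesh m < sup A - s by near: m; apply: mesh_lt; rewrite subr_gt0.
apply/eqP; rewrite eq_le straddle_le//=.
have -> : (mesh m)%:E = lebesgue_measure `]sup A - mesh m, sup A[%classic.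
  by rewrite lebesgue_measure_itv/= lte_fin gtrBl h0 -EFinB subKr.
apply: le_measure; rewrite ?inE//; first exact: measurable_straddle (ltW h0).
move=> v /=; rewrite in_itv/= => /andP[Av vA].
have sv : s < v by rewrite (lt_trans _ Av)// ltrBrDr -ltrBrDl.
have v0 : 0 <= v by rewrite (le_trans s0)// ltW.
split.
  by rewrite sv/= (le_trans (ltW vA))//; apply: ge_sup => //; exists s.
split.
  have [|v1 [sv1 Xv1] vv1] := @sup_adherent _ A (sup A - v) _ supA.
    by rewrite subr_gt0.
  by rewrite subKr in vv1; rewrite (le_lt_trans _ Xv1)// path_homo// ltW.
have vh0 : 0 <= v + mesh m by rewrite addr_ge0// ltW.
rewrite leNgt; apply/negP => Xvr; apply: Xzr; exists (v + mesh m) => //.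
rewrite Xvr andbT leNgt; apply/negP => Xvz.
have : v + mesh m <= sup A.
  by apply: ub_le_sup; [exists t|split=> //; rewrite (le_trans (ltW sv))// lerDl ltW].
by rewrite leNgt -ltrBlDr Av.
Unshelve. all: by end_near. Qed.

(** A path that visits [z, r[ remains below [r] for some time after the visit, by
    right-continuity, and then no short increment goes from below [z] to [r]. *)
Lemma straddle_nojump : s <= t -> ~ [/\ X s < z, r <= X t & ~ hits X z r] ->
  \forall m \near \oo, straddle (mesh m) = set0.
Proof.
move=> st nj; have t0 : 0 <= t := le_trans s0 st.
have [zXs|Xsz] := leP z (X s).
  apply: nearW => m; apply/seteqP; split=> // v [/andP[sv vt] [Xvz _]].
  by move: (path_incr rX s0 sv); rewrite ltNge (le_trans (ltW Xvz)).
have [Xtr|rXt] := ltP (X t) r.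
  have [e e0 Xter] := path_stays_below t0 Xtr.
  near=> m; apply/seteqP; split=> // v [/andP[sv vt] [Xvz rXv]].
  have me : mesh m < e by near: m; exact: mesh_lt.
  have : X (v + mesh m) <= X (t + e).
    rewrite path_homo ?addr_ge0 ?(ltW (mesh_gt0 _))//; last exact/lerD/ltW.
    by rewrite (le_trans s0)// ltW.
  by rewrite leNgt (lt_le_trans Xter).
have [u u0 /andP[zXu Xur]] : hits X z r.
  by apply: contrapT => nh; apply: nj.
have [e e0 Xuer] := path_stays_below u0 Xur.
near=> m; apply/seteqP; split=> // v [/andP[sv vt] [Xvz rXv]].
have me : mesh m < e by near: m; exact: mesh_lt.
have v0 : 0 <= v by rewrite (le_trans s0)// ltW.
have vu : v < u by apply: path_ltW => //; exact: lt_le_trans zXu.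
have : X (v + mesh m) <= X (u + e).
  by rewrite path_homo ?addr_ge0 ?(ltW (mesh_gt0 _))//; apply: lerD; exact: ltW.
by rewrite leNgt (lt_le_trans Xuer).
Unshelve. all: by end_near. Qed.

End straddle.

Lemma left_limit_cvg s : 0 < s -> cvg (X v @[v --> s^'-]).
Proof.
move=> s0; apply: nondecreasing_at_left_is_cvgr; near=> x.
  have x0 : 0 <= x by near: x; exact: nbhs_left_ge.
  move=> v1 v2; rewrite !in_itv/= => /andP[xv1 _] _; apply: path_homo.
  exact: le_trans x0 (ltW xv1).
have x0 : 0 <= x by near: x; exact: nbhs_left_ge.
exists (X s) => _ [v + <-]; rewrite /= in_itv/= => /andP[xv1 vs].
exact: path_homo (le_trans x0 (ltW xv1)) (ltW vs).
Unshelve. all: by end_near. Qed.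

Lemma left_limit_ge s u : 0 <= u -> u < s -> X u <= lim (X v @[v --> s^'-]).
Proof.
move=> u0 us; apply: limr_ge; first exact/left_limit_cvg/(le_lt_trans u0).
near=> v; apply: path_homo => //; near: v; exact: nbhs_left_ge.
Unshelve. all: by end_near. Qed.

Lemma left_limit_adherent s z : 0 < s -> z < lim (X v @[v --> s^'-]) ->
  exists2 u, 0 <= u < s & z < X u.
Proof.
move=> s0 zl; apply: contrapT => nu.
suff : lim (X v @[v --> s^'-]) <= z by rewrite leNgt zl.
apply: limr_le; first exact: left_limit_cvg.
near=> v; rewrite leNgt; apply/negP => zXv; apply: nu; exists v => //.
apply/andP; split; near: v; first exact: nbhs_left_ge.
exact: nbhs_left_lt.
Unshelve. all: by end_near. Qed.

Lemma left_limit_le s : 0 < s -> lim (X v @[v --> s^'-]) <= X s.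
Proof.
move=> s0; rewrite leNgt; apply/negP => /(left_limit_adherent s0)[u].
by move=> /andP[u0 us]; rewrite ltNge path_homo// ltW.
Qed.

(** Around each time the oscillation of the path, apart from its jump there, is
    arbitrarily small, so short increments nearby are below [a]; a uniform mesh exists
    by compactness of [0, 1]. *)
Lemma small_increments a : 0 < a ->
  (forall s, 0 < s -> s <= 1 -> X s - lim (X v @[v --> s^'-]) < a) ->
  \forall m \near \oo, forall k, (k < 2 ^ m)%N ->
    X (dyadic m k.+1) - X (dyadic m k) < a.
Proof.
move=> a0 small.
suff H : \forall m \near \oo, `[0, 1]%classic `<=`
    (fun v => X (v + mesh m) - X v < a).
  near=> m => k km; rewrite dyadicS.
  have : `[0, 1]%classic `<=` (fun v => X (v + mesh m) - X v < a) by near: m.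
  apply; rewrite /= in_itv/= dyadic_ge0/= /dyadic ler_pdivrMr ?exprn_gt0//.
  by rewrite mul1r -natrX ler_nat ltnW.
have /near_covering_withinP : near_covering (`[0, 1]%classic : set R).
  exact/compact_near_coveringP/segment_compact.
apply => s; rewrite /= in_itv/= => /andP[].
rewrite le_eqVlt => /predU1P[<- _|s0 s1].
  have [|e e0 Xe] := @path_stays_below 0 a (lexx 0); first by rewrite path_0.
  exists (`](- 1), (e / 2)[%classic, [set m | mesh m < e / 2]).
    split=> /=; last by apply: mesh_lt; rewrite divr_gt0.
    by apply: near_in_itvoo; rewrite in_itv/= ltrN10 divr_gt0.
  move=> [v m] /= []; rewrite in_itv/= => /andP[_ ve] me.
  rewrite in_itv/= => /andP[v0 _].
  have : X (v + mesh m) <= X (0 + e).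
    by rewrite path_homo ?addr_ge0 ?(ltW (mesh_gt0 _))//; lra.
  have : X 0 <= X v by exact: path_homo.
  by rewrite path_0//; lra.
have := small s s0 s1; set l := lim _ => sl.
(* The jump at [s] leaves the margin [g], half of which is granted to either side. *)
pose g := a - (X s - l).
have [|u /andP[u0 us] Xu] := @left_limit_adherent s (l - g / 2) s0.
  by rewrite -/l /g; lra.
have [|e e0 Xe] := @path_stays_below s (X s + g / 2) (ltW s0).
  by rewrite /g; lra.
exists (`]u, (s + e / 2)[%classic, [set m | mesh m < e / 2]).
  split=> /=; last by apply: mesh_lt; rewrite divr_gt0.
  by apply: near_in_itvoo; rewrite in_itv/= us/=; lra.
move=> [v m] /= []; rewrite in_itv/= => /andP[uv ve] me.
rewrite in_itv/= => /andP[v0 _].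
have : X (v + mesh m) <= X (s + e).
  by rewrite path_homo ?addr_ge0 ?(ltW (mesh_gt0 _))//; lra.
have : X u <= X v by apply: path_homo => //; exact: ltW.
by rewrite /g in Xu Xe; lra.
Unshelve. all: by end_near. Qed.

Lemma not_creeps_jump s y : 0 < s -> lim (X v @[v --> s^'-]) < y <= X s ->
  ~ creeps X y.
Proof.
move=> s0 /andP[ly yX] cy.
have /cy[u u0 /andP[zX Xy]] : (lim (X v @[v --> s^'-]) + y) / 2 < y by lra.
have : X u <= lim (X v @[v --> s^'-]).
  by apply: left_limit_ge => //; apply: path_ltW; rewrite ?ltW// (lt_le_trans Xy).
by lra.
Qed.

(** The jumps of a pure jump path fill disjoint intervals ]X (s-), X s] of total
    length [X t], and none of their points is crept up to.  Finitely many jumps already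
    exhaust the length up to [e], which leaves at most [e] for [D]. *)
Lemma creeps_null t : 0 <= t ->
  (X t)%:E = (\esum_(s in `]0%R, t]) (X s - lim (X v @[v --> s^'-]))%:E)%E ->
  forall D, measurable D -> D `<=` [set y | 0 < y <= X t /\ creeps X y] ->
  lebesgue_measure D = 0%E.
Proof.
move=> t0 XE D mD DC.
apply/eqP; rewrite eq_le measure_ge0 andbT.
apply/lee_addgt0Pr => e e0; rewrite add0e.
have : ((X t - e)%:E < \esum_(s in `]0%R, t]) (X s - lim (X v @[v --> s^'-]))%:E)%E.
  by rewrite -XE lte_fin gtrBl.
move=> /ereal_sup_gt[_ [A [finA At] <-]] XA.
pose F s := `]lim (X v @[v --> s^'-]), X s]%classic.
have A0 s : A s -> 0 < s by move=> /At; rewrite /= in_itv/= => /andP[].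
have tF : trivIset A F.
  move=> s1 s2 As1 As2 [y []].
  wlog : s1 s2 As1 As2 / s1 < s2.
    have [|s21 H F1 F2|//] := ltgtP s1 s2; first by move=> + H; apply: H.
    by apply/esym; exact: (H _ _ As2 As1).
  move=> s12; rewrite /F/= !in_itv/= => /andP[_ yX] /andP[ly _].
  by have := left_limit_ge (ltW (A0 _ As1)) s12; lra.
have mF s : measurable (F s) by exact: measurable_itv.
have FE : lebesgue_measure (\bigcup_(s in A) F s) =
    (\sum_(s \in A) (X s - lim (X v @[v --> s^'-]))%:E)%E.
  rewrite measure_fin_bigcup// /=; last by move=> s _; exact: mF.
  apply: eq_fsbigr => s /[!inE] As; rewrite /F.
  rewrite lebesgue_measure_itv/= lte_fin; case: ltP => //.
  by have := left_limit_le (A0 _ As); move=> ? ?; congr EFin; lra.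
have mU : measurable (\bigcup_(s in A) F s) by apply: fin_bigcup_measurable.
have DF : D `&` \bigcup_(s in A) F s = set0.
  apply/seteqP; split=> // y [/DC[_ cy] [s As]]; rewrite /F/= in_itv/= => ly.
  exact: not_creeps_jump (A0 _ As) ly cy.
have : (lebesgue_measure D + lebesgue_measure (\bigcup_(s in A) F s) <= (X t)%:E)%E.
  rewrite -measureU//.
  apply: (@le_trans _ _ (lebesgue_measure `]0%R, X t]%classic)); last first.
    rewrite lebesgue_measure_itv/= lte_fin; case: ltP => //; rewrite ?sube0// => ?.
    by rewrite lee_fin -(path_0 rX) path_homo.
  apply: le_measure; rewrite ?inE//; [exact: measurableU|].
  move=> y [/DC[]//|[s As]]; rewrite /F/= !in_itv/= => /andP[ly yX].
  have := At _ As; rewrite /= in_itv/= => /andP[s0 st].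
  rewrite (le_trans yX) ?path_homo ?(ltW s0)// andbT (le_lt_trans _ ly)//.
  by rewrite -(path_0 rX) left_limit_ge.
rewrite FE => H.
have : (lebesgue_measure D + (X t - e)%:E <= (X t)%:E)%E.
  by apply: le_trans H; rewrite leeD2l// ltW.
by rewrite -leeBrDr// -EFinB opprB subrKC.
Qed.

End regular.

End paths.

(** * Integrals over product spaces *)

Section measure_lemmas.
Context {R : realType}.

(** By monotonicity and right-continuity [Y v w < c] iff [Y q w < c] for some rational
    [q > v], which exhibits a countable union of rectangles. *)
Lemma measurable_fun_monotone_rcont d' (T' : measurableType d') (Y : R -> T' -> R) :
  (forall v, measurable_fun setT (Y v)) ->
  (forall w u v, u <= v -> Y u w <= Y v w) ->
  (forall w v c, Y v w < c -> exists2 u, v < u & Y u w < c) ->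
  measurable_fun setT (fun z : T' * R => Y z.2 z.1).
Proof.
move=> mY ndY rcY; apply: (measurability _ (RGenInftyO.measurableE R)).
move=> _ [_ [c ->] <-]; rewrite setTI.
rewrite (_ : _ @^-1` _ =
  \bigcup_(q : rat) (Y (ratr q) @^-1` `]-oo, c[ `*` `]-oo, ratr q[%classic)).
  apply: bigcupT_measurable_rat => q; apply: measurableX => //.
  by rewrite -[X in measurable X]setTI; exact: mY.
apply/seteqP; split=> [[w v]/=|[w v] [q _] /= []]; rewrite !in_itv/=.
  move=> /rcY[u vu Yu]; have [q] := rat_in_itvoo vu.
  rewrite in_itv/= => /andP[vq qu]; exists q => //; split; rewrite /= in_itv//=.
  exact: le_lt_trans (ndY _ _ _ (ltW qu)) Yu.
by move=> Yq vq; exact: le_lt_trans (ndY _ _ _ (ltW vq)) Yq.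
Qed.

Lemma ge0_integral_setX1 d1 d2 (T1 : measurableType d1) (T2 : measurableType d2)
    (m1 : {sigma_finite_measure set T1 -> \bar R})
    (m2 : {sigma_finite_measure set T2 -> \bar R}) A B (f : T1 * T2 -> \bar R) :
  measurable A -> measurable B -> measurable_fun setT f ->
  (forall z, 0 <= f z)%E ->
  (\int[m1 \x m2]_(z in A `*` B) f z =
   \int[m1]_(x in A) \int[m2]_(y in B) f (x, y))%E.
Proof.
move=> mA mB mf f0; rewrite integral_mkcond fubini_tonelli1/=; last first.
- by move=> z; rewrite patchE; case: ifP.
- apply/measurable_restrict => //; first exact: measurableX.
  exact: measurable_funTS.
rewrite [RHS]integral_mkcond; apply: eq_integral => x _.
rewrite /fubini_F patchE; case: ifPn => [|].
  rewrite inE => Ax; rewrite [RHS]integral_mkcond; apply: eq_integral => y _.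
  rewrite !patchE; congr (if _ then _ else _).
  by apply/idP/idP; rewrite !inE => //= -[].
rewrite notin_setE => nAx; apply: integral0_eq => y _; rewrite patchE ifF//.
by apply/negbTE; rewrite notin_setE => -[].
Qed.

Lemma ge0_integral_setX2 d1 d2 (T1 : measurableType d1) (T2 : measurableType d2)
    (m1 : {sigma_finite_measure set T1 -> \bar R})
    (m2 : {sigma_finite_measure set T2 -> \bar R}) A B (f : T1 * T2 -> \bar R) :
  measurable A -> measurable B -> measurable_fun setT f ->
  (forall z, 0 <= f z)%E ->
  (\int[m1 \x m2]_(z in A `*` B) f z =
   \int[m2]_(y in B) \int[m1]_(x in A) f (x, y))%E.
Proof.
move=> mA mB mf f0; rewrite integral_mkcond fubini_tonelli2/=; last first.
- by move=> z; rewrite patchE; case: ifP.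
- apply/measurable_restrict => //; first exact: measurableX.
  exact: measurable_funTS.
rewrite [RHS]integral_mkcond; apply: eq_integral => y _.
rewrite /fubini_G patchE; case: ifPn => [|].
  rewrite inE => Ay; rewrite [RHS]integral_mkcond; apply: eq_integral => x _.
  rewrite !patchE; congr (if _ then _ else _).
  by apply/idP/idP; rewrite !inE => //= -[].
rewrite notin_setE => nAx; apply: integral0_eq => x _; rewrite patchE ifF//.
by apply/negbTE; rewrite notin_setE => -[].
Qed.

Lemma ge0_integral_indicT d' (T' : measurableType d') (mu : {measure set T' -> \bar R})
  (A : set T') : measurable A -> (\int[mu]_w (\1_A w)%:E = mu A)%E.
Proof. by move=> mA; rewrite integral_indic// setIT. Qed.

Lemma measurable_integral_fst d1 d2 (T1 : measurableType d1) (T2 : measurableType d2)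
    (m1 : {sigma_finite_measure set T1 -> \bar R}) (A : set T1) (f : T1 * T2 -> \bar R) :
  measurable A -> measurable_fun setT f -> (forall x, 0 <= f x)%E ->
  measurable_fun setT (fun v => \int[m1]_(w in A) f (w, v))%E.
Proof.
move=> mA mf f0.
rewrite (_ : (fun v => _) = fubini_G m1 (f \_ (A `*` setT))); last first.
  apply/funext => v; rewrite /fubini_G [LHS]integral_mkcond; apply: eq_integral => w _.
  by rewrite !patchE; congr (if _ then _ else _); apply/idP/idP; rewrite !inE//= => -[].
apply: measurable_fun_fubini_tonelli_G.
  apply/measurable_restrict => //; first exact: measurableX.
  exact: measurable_funTS.
by move=> x; rewrite patchE; case: ifP.
Qed.

Lemma measurable_integral_snd d1 d2 (T1 : measurableType d1) (T2 : measurableType d2)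
    (m2 : {sigma_finite_measure set T2 -> \bar R}) (B : set T2) (f : T1 * T2 -> \bar R) :
  measurable B -> measurable_fun setT f -> (forall x, 0 <= f x)%E ->
  measurable_fun setT (fun x => \int[m2]_(y in B) f (x, y))%E.
Proof.
move=> mB mf f0.
rewrite (_ : (fun x => _) = fubini_F m2 (f \_ (setT `*` B))); last first.
  apply/funext => v; rewrite /fubini_F [LHS]integral_mkcond; apply: eq_integral => w _.
  by rewrite !patchE; congr (if _ then _ else _); apply/idP/idP; rewrite !inE//= => -[].
apply: measurable_fun_fubini_tonelli_F.
  apply/measurable_restrict => //; first exact: measurableX.
  exact: measurable_funTS.
by move=> x; rewrite patchE; case: ifP.
Qed.

Lemma tonelli_section d1 (T1 : measurableType d1)
    (m1 : {sigma_finite_measure set T1 -> \bar R})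
    (D : set T1) (E : set (T1 * R)) : measurable D -> measurable E ->
  (\int[m1]_(x in D) lebesgue_measure (xsection E x) =
   \int[lebesgue_measure]_c m1 (D `&` ysection E c))%E.
Proof.
move=> mD mE.
have mf : measurable_fun setT (fun x : T1 * R => (\1_E x)%:E : \bar R).
  exact/measurable_EFinP/measurable_indic.
have f0 (x : T1 * R) : (0 <= (\1_E x)%:E :> \bar R)%E by rewrite lee_fin.
transitivity (\int[m1]_(x in D) \int[lebesgue_measure]_(c in setT) (\1_E (x, c))%:E)%E.
  apply: eq_integral => x _; rewrite -ge0_integral_indicT; last exact: measurable_xsection.
  by apply: eq_integral => c _; rewrite !indicE mem_xsection.
rewrite -(ge0_integral_setX1 m1 lebesgue_measure mD measurableT mf f0).
rewrite (ge0_integral_setX2 m1 lebesgue_measure mD measurableT mf f0).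
apply: eq_integral => c _.
transitivity (\int[m1]_(x in D) (\1_(ysection E c) x)%:E)%E.
  by apply: eq_integral => x _; rewrite !indicE mem_ysection.
by rewrite (integral_indic m1 mD (measurable_ysection c mE)) setIC.
Qed.

Lemma length_oc (a b : R) : a <= b ->
  lebesgue_measure [set c : R | a < c <= b] = (b - a)%:E.
Proof.
move=> ab; rewrite (_ : [set _ | _] = `]a, b]%classic); last first.
  by apply/seteqP; split=> x; rewrite /= in_itv.
rewrite lebesgue_measure_itv/= lte_fin; case: ltP => [|ba]; first by rewrite -EFinB.
by rewrite (_ : a = b) ?subrr//; apply/eqP; rewrite eq_le ab.
Qed.

Lemma measurable_shift (s : R) :
  measurable_fun setT (fun x : R => s + x : measurableTypeR R).
Proof. exact: measurable_funD. Qed.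

Lemma lebesgue_measure_shift (s : R) (A : set R) : measurable A ->
  pushforward lebesgue_measure (fun x : R => s + x : measurableTypeR R) A = lebesgue_measure A.
Proof.
move=> mA; apply/esym/lebesgue_measure_unique => //=.
  exact: measurable_shift.
move=> _ _ [[a b] _ <-].
rewrite /pushforward (_ : _ @^-1` _ = `](a - s), (b - s)]%classic).
  rewrite !lebesgue_measure_itv/= !lte_fin ltrD2r -!EFinB.
  by case: ifP => // _; congr EFin; lra.
by apply/seteqP; split=> x /=; rewrite !in_itv/= ltrBlDl lerBrDl.
Qed.

Lemma ge0_integral_shift (s t : R) (f : R -> \bar R) :
  measurable_fun setT f -> (forall x, 0 <= f x)%E ->
  (\int[lebesgue_measure]_(v in `]s, (s + t)%R]) f v =
   \int[lebesgue_measure]_(u in `]0%R, t]) f (s + u)%R)%E.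
Proof.
move=> mf f0.
transitivity (\int[pushforward lebesgue_measure
  (fun x : R => (s + x)%R : measurableTypeR R)]_(v in `]s, (s + t)%R]) f v)%E.
  apply: eq_measure_integral.
    exact: measurable_shift.
  by move=> mf' A mA _; rewrite /= lebesgue_measure_shift.
rewrite ge0_integral_pushforward//=; last 2 first.
- exact: measurable_shift.
- exact: measurable_funTS.
congr (integral _ _ _); apply/seteqP; split=> x /=; rewrite !in_itv/=.
  by rewrite ltrDl lerD2l.
by rewrite ltrDl lerD2l.
Qed.

End measure_lemmas.

Section generic_measure.
Context {R : realType} {d : measure_display} {T : measurableType d}.

Lemma measurable_lt_set (f g : T -> R) : measurable_fun setT f ->
  measurable_fun setT g -> measurable [set x | f x < g x].
Proof.
move=> mf mg; have /(_ measurableT [set true]) := measurable_fun_ltr mf mg.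
by rewrite setTI; apply.
Qed.

Lemma measurable_le_set (f g : T -> R) : measurable_fun setT f ->
  measurable_fun setT g -> measurable [set x | f x <= g x].
Proof.
move=> mf mg; have /(_ measurableT [set true]) := measurable_fun_ler mf mg.
by rewrite setTI; apply.
Qed.

Lemma bounded_convergence (mu : {measure set T -> \bar R}) (D : set T) (K : R)
    (f_ : (T -> \bar R)^nat) (f : T -> \bar R) :
  measurable D -> (mu D < +oo)%E -> (forall n, measurable_fun D (f_ n)) ->
  measurable_fun D f -> (forall n x, D x -> (0 <= f_ n x)%E) ->
  (forall n x, D x -> (f_ n x <= K%:E)%E) ->
  (forall x, D x -> f_ ^~ x @ \oo --> f x) ->
  (\int[mu]_(x in D) f_ n x)%E @[n --> \oo] --> (\int[mu]_(x in D) f x)%E.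
Proof.
move=> mD Doo mf_ mf f_0 fK f_f.
have fe : {ae mu, forall x, D x -> f_ ^~ x @ \oo --> f x} by exact: aeW.
have iK : mu.-integrable D (cst K%:E).
  by apply/integrableP; split=> //; rewrite integral_cst// lte_mul_pinfty.
have fK' : {ae mu, forall x n, D x -> (`|f_ n x| <= cst K%:E x)%E}.
  by apply: aeW => x n Dx /=; rewrite gee0_abs ?f_0// fK.
by have [] := dominated_convergence mD mf_ mf fe iK fK'.
Qed.

End generic_measure.

(** * The past of the process and the Markov property *)

Section past_and_future.
Context {R : realType} {d : measure_display} {T : measurableType d}.
Variables (P : probability T R) (S : R -> T -> R).
Variable Pi : {sigma_finite_measure set R -> \bar R}.
Hypothesis hS : driftless_subordinator P S Pi.
Local Notation F := (natural_filtration S).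

Lemma subordinator_path w : regular_path (S^~ w).
Proof.
by split=> *; [exact: (sub_0 hS)|exact: (sub_incr hS)|exact: (sub_rcont hS)].
Qed.

Definition observations (s : R) : set (set T) :=
  [set A | exists (u : R) (B : set R),
         [/\ 0 <= u <= s, measurable B & A = S u @^-1` B]].

(** The sample space with the events observed up to time [s], as a measurable type of its
    own: Tonelli's theorem and the measurability lemmas for products then apply to
    functions of the past. *)
Definition past (s : R) : Type := g_sigma_algebraType (observations s).
HB.instance Definition _ s := Measurable.on (past s).

Lemma measurable_past s (A : set T) : F s A = measurable (A : set (past s)).
Proof. by []. Qed.

Lemma past_value u s : 0 <= u <= s ->
  measurable_fun (setT : set (past s)) (S u : past s -> R).
Proof.
move=> us _ B mB; rewrite setTI; apply: sub_sigma_algebra.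
by exists u, B.
Qed.

Lemma past_sub s A : F s A -> measurable A.
Proof.
apply: smallest_sub; first exact: sigma_algebra_measurable.
move=> _ [u [B [/andP[u0 _] mB ->]]].
by rewrite -[X in measurable X]setTI; exact: (sub_meas hS u0).
Qed.

Lemma past_mono s t : s <= t -> F s `<=` F t.
Proof.
move=> st; apply: sub_smallest2r; first exact: smallest_sigma_algebra.
move=> _ [u [B [/andP[u0 us] mB ->]]].
by exists u, B; rewrite u0 (le_trans us).
Qed.

Lemma measurable_past_id s : measurable_fun setT (id : T -> past s).
Proof. by move=> _ A mA; rewrite setTI; exact: past_sub mA. Qed.

Lemma measurable_increment s t : 0 <= s -> 0 <= t ->
  measurable_fun setT (fun w => S t w - S s w).
Proof. by move=> s0 t0; apply: measurable_funB; exact: (sub_meas hS). Qed.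

(** The joint law of the past of [s] and of the increment after [s] is a product measure,
    because both agree on rectangles. *)
Lemma increments_markov s u (phi : past s * R -> \bar R) : 0 <= s -> 0 <= u ->
  measurable_fun setT phi -> (forall z, 0 <= phi z)%E ->
  (\int[P]_w phi (w, S (s + u)%R w - S s w)%R =
   \int[P]_w \int[P]_w' phi (w, S u w'))%E.
Proof.
move=> s0 u0 mphi phi0; have su0 : 0 <= s + u by rewrite addr_ge0.
pose W : {mfun T >-> past s} := mfun_Sub (mem_set (@measurable_past_id s)).
pose V : {mfun T >-> R} := mfun_Sub (mem_set (sub_meas hS u0)).
have mJ : measurable_fun setT
    (fun w : T => (w : past s, S (s + u) w - S s w)).
  apply: measurable_fun_pair; first exact: (@measurable_past_id s).
  exact: measurable_increment.
pose J : {mfun T >-> (past s * R)%type} := mfun_Sub (mem_set mJ).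
transitivity (\int[distribution P J]_z phi z)%E.
  by rewrite ge0_integral_distribution.
transitivity (\int[distribution P W \x distribution P V]_z phi z)%E.
  apply: eq_measure_integral => G mG _; apply/esym.
  apply: product_measure_unique => // A B mA mB.
  rewrite /distribution /pushforward/=.
  transitivity (P (A `&` [set w | B (S (s + u) w - S s w)])); first by [].
  rewrite (sub_indep hS)// ?lerDl// (sub_stat hS)// ?lerDl//.
  by congr (_ * P _)%E; rewrite addrAC subrr add0r.
rewrite fubini_tonelli1// ge0_integral_distribution//=.
- apply: eq_integral => w _; rewrite /fubini_F/= ge0_integral_distribution//.
  exact: measurableT_comp.
- exact: measurable_fun_fubini_tonelli_F.
- by move=> w; apply: integral_ge0.
Qed.

End past_and_future.

(** * Absence of large jumps *)

Section large_jumps.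
Context {R : realType} {d : measure_display} {T : measurableType d}.
Variables (P : probability T R) (S : R -> T -> R).
Variable Pi : {sigma_finite_measure set R -> \bar R}.
Hypothesis hS : driftless_subordinator P S Pi.
Local Notation F := (natural_filtration S).

Definition tail (a : R) : R := fine (Pi `[a, +oo[%classic).

(** [Pi] integrates [min 1 y], which is at least [min 1 a] on [a, +oo[. *)
Lemma tail_fin a : 0 < a -> Pi `[a, +oo[%classic \is a fin_num.
Proof.
move=> a0; rewrite ge0_fin_numE ?measure_ge0//.
have [_ Pi1] := sub_levy hS; have m0 : 0 < Num.min 1 a by rewrite lt_min ltr01.
rewrite -(@lte_pmul2l _ (Num.min 1 a)%:E) ?lte_fin//.
rewrite [ltRHS]gt0_muley ?lte_fin//; apply: le_lt_trans Pi1.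
rewrite -integral_cst//.
apply: (@le_trans _ _ (\int[Pi]_(y in `[a, +oo[) (Num.min 1 y)%:E)%E).
  apply: ge0_le_integral => //.
  - by move=> y _; rewrite lee_fin ltW.
  - by apply/measurable_EFinP/measurable_funTS/measurable_minr.
  - move=> y; rewrite /= in_itv/= andbT => ay; rewrite lee_fin.
    by rewrite le_min ge_min lexx/= ge_min ay orbT.
apply: ge0_subset_integral => //.
- by apply/measurable_EFinP/measurable_funTS/measurable_minr.
- move=> y; rewrite /= in_itv/= andbT => y0; rewrite lee_fin.
  by rewrite le_min ler01 ltW.
- by move=> y; rewrite /= !in_itv/= !andbT; exact: lt_le_trans.
Qed.

Lemma tailE a : 0 < a -> Pi `[a, +oo[%classic = (tail a)%:E.
Proof. by move=> a0; rewrite fineK// tail_fin. Qed.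

Lemma tail_ge0 a : 0 <= tail a.
Proof. exact/fine_ge0/measure_ge0. Qed.

Definition jumps_below (a t : R) : set T :=
  [set w | forall s, 0 < s -> s <= t -> jump S s w < a].

Definition big_jumps (a t : R) : set (R * R) := `]0, t]%classic `*` `[a, +oo[%classic.

Lemma jumps_belowE a t : 0 < a -> 0 <= t ->
  jumps_below a t = [set w | jump_count S w (big_jumps a t) = 0%E].
Proof.
move=> a0 t0; apply/seteqP; split=> w /=.
  move=> Sw; rewrite /jump_count (_ : [set _ | _] = set0) ?measure0//.
  apply/seteqP; split=> // s [s0 _ []] /=; rewrite !in_itv/= andbT.
  by move=> /andP[_ st]; rewrite leNgt Sw.
rewrite /jump_count /counting; case: asboolP => // fin [] /eqP.
rewrite pnatr_eq0 cardfs_eq0 => /eqP E0 s s0 st; rewrite ltNge; apply/negP => aj.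
have : s \in fset_set [set s0 | [/\ 0 < s0, 0 < jump S s0 w &
    big_jumps a t (s0, jump S s0 w)]].
  rewrite in_fset_set//; apply/mem_set; split=> //; first exact: lt_le_trans aj.
  by split; rewrite /= in_itv/= ?s0// andbT.
by rewrite E0 in_fset0.
Qed.

Lemma big_jumps_sub a t : 0 < a ->
  big_jumps a t `<=` [set z | 0 < z.1 /\ 0 < z.2].
Proof.
move=> a0 [u y] [] /=; rewrite !in_itv/= andbT => /andP[u0 _] ay.
by split=> //; exact: lt_le_trans ay.
Qed.

Lemma measurable_jumps_below a t : 0 < a -> 0 <= t ->
  measurable (jumps_below a t).
Proof.
move=> a0 t0; rewrite jumps_belowE//; have [mN _ _] := sub_poisson hS.
have /(_ measurableT [set 0%E]) := mN _ (measurableX (measurable_itv _)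
  (measurable_itv _)) (@big_jumps_sub a t a0).
by rewrite setTI; apply.
Qed.

Lemma prob_jumps_below a t : 0 < a -> 0 <= t ->
  P (jumps_below a t) = (expR (- (t * tail a)))%:E.
Proof.
move=> a0 t0; rewrite jumps_belowE//; have [_ pN _] := sub_poisson hS.
have bE : (lebesgue_measure \x Pi)%E (big_jumps a t) = (t * tail a)%:E.
  rewrite /big_jumps product_measure1E//= lebesgue_measure_itv/= lte_fin tailE//.
  rewrite EFinM; case: ltP => t0'; first by rewrite oppr0 adde0.
  by rewrite (_ : t = 0)//; apply/eqP; rewrite eq_le t0 t0'.
have := pN (big_jumps a t) 0%N.
rewrite bE/= expr0 divr1 mulr1 => -> //; [exact: measurableX|exact: big_jumps_sub|].
exact: ltry.
Qed.

Lemma path_below_jumps_below a t w : 0 <= t -> S t w < a -> jumps_below a t w.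
Proof.
move=> t0 Sta s s0 st.
have := left_limit_ge (subordinator_path hS w) (lexx 0) s0.
have := path_homo (subordinator_path hS w) (ltW s0) st.
by rewrite /jump (path_0 (subordinator_path hS w)); lra.
Qed.

Lemma measurable_S_lt a t : 0 <= t -> measurable [set w | S t w < a].
Proof.
move=> t0; rewrite [X in measurable X](_ : _ = S t @^-1` `]-oo, a[%classic).
  by rewrite -[X in measurable X]setTI; exact: (sub_meas hS).
by apply/seteqP; split=> w; rewrite /= in_itv.
Qed.

Lemma measurable_S_ge a t : 0 <= t -> measurable [set w | a <= S t w].
Proof.
move=> t0; rewrite [X in measurable X](_ : _ = S t @^-1` `[a, +oo[%classic).
  by rewrite -[X in measurable X]setTI; exact: (sub_meas hS).
by apply/seteqP; split=> w; rewrite /= in_itv/= andbT.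
Qed.

Lemma prob_below_le a t : 0 < a -> 0 <= t ->
  (P [set w | (S t w < a)%R] <= (expR (- (t * tail a)))%:E)%E.
Proof.
move=> a0 t0; rewrite -prob_jumps_below//; apply: le_measure; rewrite ?inE.
- exact: measurable_S_lt.
- exact: measurable_jumps_below.
- by move=> w; exact: path_below_jumps_below.
Qed.

Definition steps_below (a : R) (m n : nat) : set T :=
  [set w | forall k, (k < n)%N -> S (dyadic m k.+1) w - S (dyadic m k) w < a].

Lemma steps_belowS a m n : steps_below a m n.+1 = steps_below a m n `&`
  [set w | `]-oo, a[%classic (S (dyadic m n.+1) w - S (dyadic m n) w)].
Proof.
apply/seteqP; split=> w /=.
  move=> H; split; last by rewrite in_itv/= H.
  by move=> k kn; apply: H; rewrite ltnS ltnW.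
rewrite in_itv/= => -[H1 H2] k; rewrite ltnS leq_eqVlt => /predU1P[->//|].
exact: H1.
Qed.

Lemma past_steps_below a m n : F (dyadic m n) (steps_below a m n).
Proof.
rewrite measurable_past.
elim: n => [|n IHn].
  rewrite (_ : steps_below _ _ _ = setT)//.
  by apply/seteqP; split=> // w _ k.
rewrite steps_belowS; apply: measurableI.
  by rewrite -measurable_past; apply: past_mono IHn; exact: dyadic_le.
rewrite -[X in measurable X]setTI; apply: (@measurable_funB _ (past S _)) => //.
- by apply: past_value; rewrite dyadic_ge0 lexx.
- by apply: past_value; rewrite dyadic_ge0 dyadic_le.
Qed.

Lemma prob_steps_below a m n :
  P (steps_below a m n) = (P [set w | (S (mesh m) w < a)%R] ^+ n)%E.
Proof.
elim: n => [|n IHn].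
  rewrite expe0 (_ : steps_below _ _ _ = setT) ?probability_setT//.
  by apply/seteqP; split=> // w _ k.
rewrite steps_belowS (sub_indep hS) ?dyadic_ge0 ?dyadic_le//; last first.
  exact: past_steps_below.
rewrite (sub_stat hS) ?dyadic_ge0 ?dyadic_le// IHn expeS muleC.
by congr (P _ * _)%E; apply/seteqP; split=> w /=; rewrite in_itv/= dyadicS addrC addKr.
Qed.

End large_jumps.

(** * Tails of the increments over short times *)

Section short_time_tails.
Context {R : realType} {d : measure_display} {T : measurableType d}.
Variables (P : probability T R) (S : R -> T -> R).
Variable Pi : {sigma_finite_measure set R -> \bar R}.
Hypothesis hS : driftless_subordinator P S Pi.

Definition tail_law (a : R) (t : R) : R := fine (P [set w | a <= S t w]).

Lemma tail_lawE a t : 0 <= t -> P [set w | a <= S t w] = (tail_law a t)%:E.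
Proof. by move=> t0; rewrite fineK// fin_num_measure//; exact: (measurable_S_ge hS). Qed.

Lemma tail_law_ge0 a t : 0 <= tail_law a t.
Proof. exact/fine_ge0/measure_ge0. Qed.

Lemma prob_below_tail_law a t : 0 <= t ->
  P [set w | S t w < a] = (1 - tail_law a t)%:E.
Proof.
move=> t0; rewrite EFinB -tail_lawE// -probability_setC; last exact: (measurable_S_ge hS).
by congr (P _); apply/seteqP; split=> w /=; rewrite ltNge => /negP.
Qed.

Lemma tail_law_ge a t : 0 < a -> 0 <= t -> 1 - expR (- (t * tail Pi a)) <= tail_law a t.
Proof.
move=> a0 t0; have := prob_below_le hS a0 t0.
by rewrite prob_below_tail_law// lee_fin; lra.
Qed.

(** A quantitative form of the lower bound in [rate_cvg], from
    [P (S_h < a) <= exp (- h Pi [a, +oo[)]. *)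
Lemma rate_ge a m : 0 < a ->
  tail Pi a - tail Pi a ^+ 2 * mesh m <= 2 ^+ m * tail_law a (mesh m).
Proof.
move=> a0; have h0 := @mesh_gt0 R m; have T0 := tail_ge0 Pi a.
have hE : 2 ^+ m * mesh m = 1 :> R by rewrite divff// expf_neq0.
have N0 : 0 < 2 ^+ m :> R by rewrite exprn_gt0.
have := tail_law_ge a0 (ltW h0).
set L := tail Pi a in T0 *; set h := mesh m in h0 hE *.
have eh : expR (- (h * L)) * (1 + h * L) <= 1.
  by rewrite expRN mulrC ler_pdivrMr ?expR_gt0// mul1r expR_ge1Dx.
have hL : 0 <= h * L by rewrite mulr_ge0// ltW.
(* [exp (- y) <= 1 / (1 + y) <= 1 - y + y^2] for [y = h * L]. *)
have e2 : 1 - h * L + (h * L) ^+ 2 >= expR (- (h * L)).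
  have : 0 <= (h * L) ^+ 3 by rewrite exprn_ge0.
  have : 0 < expR (- (h * L)) by rewrite expR_gt0.
  by set e := expR _ in eh *; set y := h * L in eh hL *; nra.
move=> xge.
have : 2 ^+ m * (h * L - (h * L) ^+ 2) <= 2 ^+ m * tail_law a h.
  by rewrite ler_pM2l//; lra.
have -> : 2 ^+ m * (h * L - (h * L) ^+ 2) = (2 ^+ m * h) * (L - L ^+ 2 * h).
  by ring.
by rewrite hE mul1r.
Qed.

Lemma measurable_steps_below a m n : measurable (steps_below S a m n).
Proof. exact: (past_sub hS (@past_steps_below _ _ _ S a m n)). Qed.

Lemma steps_below_le a m : 0 < a ->
  (P (steps_below S a m (2 ^ m)) <= (expR (- tail Pi a))%:E)%E.
Proof.
move=> a0; rewrite (prob_steps_below hS).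
have h0 : 0 <= mesh m :> R by rewrite ltW// mesh_gt0.
apply: (@le_trans _ _ ((expR (- (mesh m * tail Pi a)))%:E ^+ (2 ^ m))%E).
  rewrite prob_below_tail_law// -!EFin_expe lee_fin lerXn2r// ?nnegrE ?expR_ge0//.
    have : (P [set w | S (mesh m) w < a]%R <= 1)%E.
      by rewrite probability_le1//; exact: (measurable_S_lt hS).
    have : (0 <= P [set w | S (mesh m) w < a]%R)%E by [].
    by rewrite prob_below_tail_law// lee_fin.
  by have := prob_below_le hS a0 h0; rewrite prob_below_tail_law.
rewrite -EFin_expe lee_fin -expRM_natl natrX mulrN mulrA divff ?mul1r//.
Qed.

(** The events increase with the mesh, since an increment over a cell bounds those over
    its halves.  They eventually contain every path without jump of size at least [a]
    ([small_increments]), which bounds the limit from below; the upper bound holds for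
    every mesh because an increment below [a] leaves room only for jumps below [a]. *)
Lemma steps_below_cvg a : 0 < a ->
  P (steps_below S a m (2 ^ m)) @[m --> \oo] --> (expR (- tail Pi a))%:E.
Proof.
move=> a0; pose G m := steps_below S a m (2 ^ m).
have mG m : measurable (G m) by exact: measurable_steps_below.
have ndG : nondecreasing_seq G.
  apply/nondecreasing_seqP => m; apply/subsetPset => w Gw k km.
  have k2 : (k./2 < 2 ^ m)%N.
    by rewrite ltn_half_double -muln2 -expnSr.
  apply: le_lt_trans (Gw _ k2).
  have kE := odd_double_half k.
  have d1 : dyadic m k./2 <= dyadic m.+1 k :> R.
    by rewrite -(dyadic_refine m k./2) dyadic_le// -[leqRHS]kE leq_addl.
  have d2 : dyadic m.+1 k.+1 <= dyadic m k./2.+1 :> R.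
    rewrite -(dyadic_refine m k./2.+1) dyadic_le// doubleS -{1}kE ltnS -addn1 addnC leq_add2l.
    by case: (odd k).
  have X := subordinator_path hS w.
  by apply: lerB; apply: (path_homo X) => //; rewrite dyadic_ge0.
have cG := @nondecreasing_cvg_mu _ _ _ P G mG (bigcupT_measurable G mG) ndG.
suff <- : P (\bigcup_m G m) = (expR (- tail Pi a))%:E by exact: cG.
apply/eqP; rewrite eq_le; apply/andP; split.
  rewrite -(cvg_lim _ cG)//; apply: lime_le.
    by apply/cvg_ex; exists (P (\bigcup_m G m)).
  by apply: nearW => m; exact: steps_below_le.
rewrite -[X in expR (- X)]mul1r -(prob_jumps_below hS)//.
apply: le_measure; rewrite ?inE.
- exact: (measurable_jumps_below hS).
- exact: bigcupT_measurable.
move=> w jw; have := @small_increments _ _ (subordinator_path hS w) _ a0.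
move=> /(_ jw) H; near \oo => m; exists m => //; near: m; exact: H.
Unshelve. all: by end_near. Qed.

(** With [p] the probability that an increment over a cell reaches [a],
    [(1 - p)^(2^m)] tends to [exp (- Pi [a, +oo[)] by [steps_below_cvg]; since
    [1 - p <= exp (- p)], this bounds [2^m p] from above. *)
Lemma rate_cvg a : 0 < a ->
  2 ^+ m * tail_law a (mesh m) @[m --> \oo] --> tail Pi a.
Proof.
move=> a0; apply/cvgrPdist_lt => e e0.
have low : tail Pi a - tail Pi a ^+ 2 * mesh m @[m --> \oo] --> tail Pi a.
  rewrite -[X in _ --> X]subr0; apply: cvgB; first exact: cvg_cst.
  rewrite -(mulr0 (tail Pi a ^+ 2)).
  by apply: cvgM; [exact: cvg_cst|exact: mesh_cvg0].
have up : \forall m \near \oo,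
    ((expR (- (tail Pi a + e)))%:E < P (steps_below S a m (2 ^ m)))%E.
  have /fine_cvgP[_ cS] := steps_below_cvg a0.
  near=> m; rewrite -[ltRHS]fineK; last first.
    by rewrite fin_num_measure//; exact: measurable_steps_below.
  rewrite lte_fin; near: m; apply: (cvgr_gt _ cS).
  by rewrite ltr_expR; lra.
near=> m.
have h0 : 0 <= mesh m :> R by rewrite ltW// mesh_gt0.
have : ((expR (- (tail Pi a + e)))%:E < P (steps_below S a m (2 ^ m)))%E by near: m.
rewrite (prob_steps_below hS) prob_below_tail_law// -EFin_expe lte_fin => up1.
have : tail Pi a - e < tail Pi a - tail Pi a ^+ 2 * mesh m.
  by near: m; apply: (cvgr_gt _ low); lra.
have := rate_ge m a0; set y := 2 ^+ m * _ => low1 low2.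
suff : y < tail Pi a + e by rewrite ltr_norml; lra.
rewrite -ltrN2 -ltr_expR; apply: lt_le_trans up1 _.
rewrite -mulrN -natrX expRM_natl lerXn2r// ?nnegrE ?expR_ge0//.
  rewrite -lee_fin -prob_below_tail_law//.
by have := expR_ge1Dx (- tail_law a (mesh m)).
Unshelve. all: by end_near. Qed.

End short_time_tails.

(** * Hitting an interval and creeping up to a level *)

Section hitting.
Context {R : realType} {d : measure_display} {T : measurableType d}.
Variables (P : probability T R) (S : R -> T -> R).
Variable Pi : {sigma_finite_measure set R -> \bar R}.
Hypothesis hS : driftless_subordinator P S Pi.

(** The process is only controlled at times [v >= 0].  Extending it to all [v] gives a
    function on [T * R] that is jointly measurable. *)
Definition S0 (v : R) (w : T) : R := S (Num.max v 0) w.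

Lemma S0E v w : 0 <= v -> S0 v w = S v w.
Proof. by move=> v0; rewrite /S0 max_l. Qed.

Lemma measurable_S0 : measurable_fun setT (fun z : T * R => S0 z.2 z.1).
Proof.
apply: (measurable_fun_monotone_rcont (Y := S0)) => [v|w u v uv|w v c].
- by apply: (sub_meas hS); rewrite le_max lexx orbT.
- apply: (path_homo (subordinator_path hS w)).
    by rewrite le_max lexx orbT.
  by rewrite ge_max !le_max uv lexx orbT.
- have v0 : 0 <= Num.max v 0 by rewrite le_max lexx orbT.
  rewrite /S0 => /(path_stays_below (subordinator_path hS w) v0)[e e0 Se].
  exists (Num.max v 0 + e); first by rewrite (@le_lt_trans _ _ (Num.max v 0)) ?ltrDl// le_max lexx.
  by rewrite max_l// addr_ge0// ltW.
Qed.

(** On [0, t] this is [S], but its value at every [v] is an observation of the past of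
    [t]; it serves to show that the compensator is adapted. *)
Definition Sclamp (t v : R) (w : T) : R := S (Num.min (Num.max v 0) t) w.

Lemma SclampE t v w : 0 <= v <= t -> Sclamp t v w = S v w.
Proof. by move=> /andP[v0 vt]; rewrite /Sclamp max_l// min_l. Qed.

Lemma measurable_Sclamp t : 0 <= t ->
  measurable_fun setT (fun z : past S t * R => Sclamp t z.2 z.1).
Proof.
move=> t0; have c0 v : 0 <= Num.min (Num.max v 0) t.
  by rewrite le_min t0 andbT le_max lexx orbT.
apply: (@measurable_fun_monotone_rcont _ _ (past S t) (Sclamp t)) => [v|w u v uv|w v c].
- by apply: past_value; rewrite c0/= ge_min lexx orbT.
- apply: (path_homo (subordinator_path hS w)) => //.
  by rewrite le_min !ge_min ge_max !le_max uv !lexx !orbT.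
- rewrite /Sclamp => Sc; have [tv|vt] := leP t (Num.max v 0).
    exists (v + 1); first by rewrite ltrDl.
    apply: le_lt_trans Sc; apply: (path_homo (subordinator_path hS w)) => //.
    by rewrite (min_r tv) ge_min lexx orbT.
  rewrite min_l ?(ltW vt)// in Sc.
  have v0 : 0 <= Num.max v 0 by rewrite le_max lexx orbT.
  have [e e0 Se] := path_stays_below (subordinator_path hS w) v0 Sc.
  exists (Num.max v 0 + e); first by rewrite (@le_lt_trans _ _ (Num.max v 0)) ?ltrDl// le_max lexx.
  apply: le_lt_trans Se; apply: (path_homo (subordinator_path hS w)) => //.
  by rewrite ge_min max_l ?lexx// addr_ge0// ltW.
Qed.

Definition hit (z r : R) : set T := [set w | hits (S^~ w) z r].
Definition creep (r : R) : set T := [set w | creeps (S^~ w) r].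

(** By right-continuity a visit to [z, r[ lasts for some time, hence is seen at a dyadic
    time. *)
Lemma hitE z r : hit z r = \bigcup_m \bigcup_k
  [set w | z <= S (dyadic m k) w < r].
Proof.
apply/seteqP; split=> w /=.
  move=> /(hits_dyadic (subordinator_path hS w)) H; near \oo => m.
  have [k zr] : exists k, z <= S (dyadic m k) w < r by near: m; exact: H.
  by exists m => //; exists k.
by move=> [m _ [k _]] zr; exists (dyadic m k) => //; exact: dyadic_ge0.
Unshelve. all: by end_near. Qed.

Lemma measurable_hit_joint (z r : R * T -> R) :
  measurable_fun setT z -> measurable_fun setT r ->
  measurable [set x | hit (z x) (r x) x.2].
Proof.
move=> mz mr; rewrite (_ : [set x | _] = \bigcup_m \bigcup_k
    ([set x | z x <= S (dyadic m k) x.2] `&` [set x | S (dyadic m k) x.2 < r x])).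
  apply: bigcupT_measurable => m; apply: bigcupT_measurable => k.
  have mS : measurable_fun setT (fun x : R * T => S (dyadic m k) x.2).
    by apply: (measurableT_comp (sub_meas hS _)) => //; exact: dyadic_ge0.
  by apply: measurableI; [exact: measurable_le_set|exact: measurable_lt_set].
apply/seteqP; split=> x /=; rewrite hitE => -[m _ [k _]].
  by move=> /andP[? ?]; exists m => //; exists k.
by move=> [/= ? ?]; exists m => //; exists k => //=; apply/andP.
Qed.

Lemma measurable_hit z r : measurable (hit z r).
Proof.
rewrite hitE; apply: bigcupT_measurable => m; apply: bigcupT_measurable => k.
rewrite (_ : [set _ | _] = [set w | z <= S (dyadic m k) w] `&` [set w | S (dyadic m k) w < r]).
  apply: measurableI; first exact/(measurable_S_ge hS)/dyadic_ge0.
  exact/(measurable_S_lt hS)/dyadic_ge0.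
by apply/seteqP; split=> w /=; [move=> /andP|move=> [-> ->]].
Qed.

Lemma creepE r : creep r = \bigcap_n hit (r - n.+1%:R^-1) r.
Proof.
apply/seteqP; split=> w cw.
  by move=> n _; apply: cw; rewrite ltrBlDr ltrDl.
move=> z zr; have [n zn] := ltr_add_invr zr.
have [u u0 /andP[nu ur]] := cw n Logic.I; exists u => //; rewrite ur andbT.
by apply: le_trans nu; rewrite lerBrDr ltW.
Qed.

Lemma measurable_creep r : measurable (creep r).
Proof. by rewrite creepE; apply: bigcapT_measurable => n; exact: measurable_hit. Qed.

Lemma measurable_creep_joint : measurable [set x : R * T | creep x.1 x.2].
Proof.
rewrite (_ : [set x | _] = \bigcap_n [set x | hit (x.1 - n.+1%:R^-1) x.1 x.2]).
  apply: bigcapT_measurable => n; apply: measurable_hit_joint => //.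
  exact: measurable_funB.
by apply/seteqP; split=> x /=; rewrite creepE.
Qed.

Lemma sub_hit z z' r r' : z' <= z -> r <= r' -> hit z r `<=` hit z' r'.
Proof.
move=> zz rr w [u u0 /andP[zu ur]]; exists u => //.
by rewrite (le_trans zz)//= (lt_le_trans ur).
Qed.

Lemma creep_hit z r : z < r -> creep r `<=` hit z r.
Proof. by move=> zr w; apply. Qed.

(** From [y < z] a leap over [z, r[ is a jump of size at least [r - y]. *)
Definition leap_rate (z r y : R) : \bar R :=
  if y < z then Pi `[r - y, +oo[%classic else 0%E.

Lemma leap_rate_ge0 z r y : (0 <= leap_rate z r y)%E.
Proof. by rewrite /leap_rate; case: ifP. Qed.

Lemma measurable_leap_rate z r : measurable_fun setT (leap_rate z r).
Proof.
pose B : set (R * R) := [set x | x.1 < z] `&` [set x | r <= x.1 + x.2].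
have mB : measurable B.
  apply: measurableI; first exact: measurable_lt_set.
  by apply: measurable_le_set => //; exact: measurable_funD.
rewrite (_ : leap_rate z r = Pi \o xsection B); first exact: measurable_fun_xsection.
apply/funext => y; rewrite /= /leap_rate; case: ltP => yz.
  congr (Pi _); apply/seteqP; split=> x.
    by rewrite /= in_itv/= andbT lerBlDl => rx; apply/xsectionP.
  by move=> /xsectionP[_]/=; rewrite in_itv/= andbT lerBlDl.
rewrite (_ : xsection B y = set0) ?measure0//.
by apply/seteqP; split=> // x /xsectionP[]/=; rewrite ltNge yz.
Qed.

(** The same for increments of duration [h] instead of jumps; for small [h] it is close to
    [h * leap_rate z r y]. *)
Definition leap_prob (h z r y : R) : \bar R :=
  if y < z then (tail_law P S (r - y) h)%:E else 0%E.

Lemma leap_prob_ge0 h z r y : (0 <= leap_prob h z r y)%E.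
Proof. by rewrite /leap_prob; case: ifP => // _; rewrite lee_fin tail_law_ge0. Qed.

Lemma measurable_leap_prob h z r : 0 <= h -> measurable_fun setT (leap_prob h z r).
Proof.
move=> h0.
pose B : set (R * T) := [set x | x.1 < z] `&` [set x | r <= x.1 + S h x.2].
have mB : measurable B.
  apply: measurableI; first exact: measurable_lt_set.
  apply: measurable_le_set => //; apply: measurable_funD => //.
  exact: (measurableT_comp (sub_meas hS h0)).
rewrite (_ : leap_prob h z r = P \o xsection B); first exact: measurable_fun_xsection.
apply/funext => y; rewrite /= /leap_prob; case: ltP => yz.
  rewrite -(tail_lawE hS)//; congr (P _); apply/seteqP; split=> w /=.
    by rewrite lerBlDl => rx; apply/xsectionP.
  by move=> /xsectionP[_]/=; rewrite lerBlDl.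
rewrite (_ : xsection B y = set0) ?measure0//.
by apply/seteqP; split=> // x /xsectionP[]/=; rewrite ltNge yz.
Qed.

End hitting.

(** * The law of a leap over an interval *)

Section leaping.
Context {R : realType} {d : measure_display} {T : measurableType d}.
Variables (P : probability T R) (S : R -> T -> R).
Variable Pi : {sigma_finite_measure set R -> \bar R}.
Hypothesis hS : driftless_subordinator P S Pi.
Local Notation F := (natural_filtration S).

Lemma prob_straddle A s z r v h : 0 <= s -> s <= v -> 0 <= h -> F s A ->
  P (A `&` [set w | S v w < z /\ r <= S (v + h) w]) =
  (\int[P]_(w in A) leap_prob P S h z r (S v w))%E.
Proof.
move=> s0 sv h0 FA; have v0 : 0 <= v := le_trans s0 sv.
have FvA : F v A by exact: past_mono FA.
pose G : set (past S v * R) := (A `*` setT) `&`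
  ([set x | S v x.1 < z] `&` [set x | r <= S v x.1 + x.2]).
have mSv : measurable_fun setT (fun x : past S v * R => S v x.1).
  by apply: (measurableT_comp (past_value _)) => //; rewrite v0 lexx.
have mG : measurable G.
  apply: measurableI; first exact: measurableX.
  apply: measurableI; first exact: measurable_lt_set.
  by apply: measurable_le_set => //; exact: measurable_funD.
have mphi : measurable_fun setT (fun x : past S v * R => (\1_G x)%:E : \bar R).
  exact/measurable_EFinP/measurable_indic.
have := increments_markov hS v0 h0 mphi => /(_ (fun _ => ltac:(by rewrite lee_fin))).
move=> E; transitivity (\int[P]_w (\1_G (w : past S v, S (v + h)%R w - S v w)%R)%:E)%E.
  rewrite -ge0_integral_indicT; last first.
    apply: measurableI; first exact: (past_sub hS FA).
    rewrite (_ : [set w | _ ] = [set w | S v w < z] `&` [set w | r <= S (v + h) w])//.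
    apply: measurableI; first exact: (measurable_S_lt hS).
    by apply: (measurable_S_ge hS); rewrite addr_ge0.
  apply: eq_integral => w _; congr (_%:E).
  rewrite !indicE; congr (nat_of_bool _)%:R; apply/idP/idP; rewrite !inE /G/=.
    by move=> [Aw [Sz rS]]; rewrite subrKC.
  by move=> [[Aw _] [Sz]]; rewrite subrKC.
rewrite E [RHS]integral_mkcond; apply: eq_integral => w _.
rewrite patchE; case: ifPn => [|/negP]; rewrite inE => Aw.
  rewrite /leap_prob; case: ltP => Sz.
    rewrite -(tail_lawE hS)// -ge0_integral_indicT; last exact: (measurable_S_ge hS).
    apply: eq_integral => w' _; congr (_%:E); rewrite !indicE; congr (nat_of_bool _)%:R.
    by apply/idP/idP; rewrite !inE /G/= lerBlDl; [move=> [_ []]|].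
  apply: integral0_eq => w' _; congr (_%:E); rewrite indicE memNset//.
  by rewrite /G/= => -[_ []]; rewrite ltNge Sz.
apply: integral0_eq => w' _; congr (_%:E); rewrite indicE memNset//.
by rewrite /G/= => -[[]].
Qed.

Lemma measurable_leap_rate_path z r :
  measurable_fun setT (fun x : T * R => leap_rate Pi z r (S0 S x.2 x.1)).
Proof. exact: (measurableT_comp (measurable_leap_rate Pi z r) (measurable_S0 hS)). Qed.

Lemma measurable_leap_prob_path h z r : 0 <= h ->
  measurable_fun setT (fun x : T * R => leap_prob P S h z r (S0 S x.2 x.1)).
Proof.
move=> h0.
exact: (measurableT_comp (measurable_leap_prob hS z r h0) (measurable_S0 hS)).
Qed.

Definition straddles (z r h : R) : set (T * R) :=
  [set x | S0 S x.2 x.1 < z] `&` [set x | r <= S0 S (x.2 + h) x.1].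

Lemma measurable_straddles z r h : measurable (straddles z r h).
Proof.
apply: measurableI; first by apply: measurable_lt_set => //; exact: (measurable_S0 hS).
apply: measurable_le_set => //.
have mg : measurable_fun setT (fun x : T * R => (x.1, x.2 + h)).
  by apply: measurable_fun_pair => //; exact: measurable_funD.
exact: (measurableT_comp (measurable_S0 hS) mg).
Qed.

Lemma straddleE s t z r h w : 0 <= s -> 0 <= h ->
  straddle (S^~ w) s t z r h = xsection (straddles z r h) w `&` `]s, t]%classic.
Proof.
move=> s0 h0; apply/seteqP; split=> v /=.
  move=> [svt [Sz rS]]; have /andP[sv vt] := svt.
  have v0 : 0 <= v by rewrite (le_trans s0)// ltW.
  split; last by rewrite in_itv.
  by apply/xsectionP; rewrite /straddles/= !S0E// addr_ge0.
move=> [/xsectionP[/=]]; rewrite in_itv/= => Sz rS svt; have /andP[sv vt] := svt.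
have v0 : 0 <= v by rewrite (le_trans s0)// ltW.
by move: Sz rS; rewrite !S0E// ?addr_ge0.
Qed.

Lemma measurable_straddle_length s t z r h : 0 <= s -> 0 <= h ->
  measurable_fun setT (fun w => lebesgue_measure (straddle (S^~ w) s t z r h)).
Proof.
move=> s0 h0; pose E := straddles z r h `&` (setT `*` `]s, t]%classic).
have mE : measurable E.
  by apply: measurableI; [exact: measurable_straddles|exact: measurableX].
rewrite (_ : (fun w => _) = lebesgue_measure \o xsection E).
  exact: measurable_fun_xsection.
apply/funext => w /=; rewrite straddleE//; congr (lebesgue_measure _).
apply/seteqP; split=> v; first by move=> [/xsectionP ? ?]; exact/xsectionP.
by move=> /xsectionP[? [_ ?]]; split=> //; exact/xsectionP.
Qed.

(** Tonelli's theorem, followed by the Markov property at each starting time [v]. *)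
Lemma straddle_integral A s t z r h : 0 <= s -> z < r -> 0 <= h -> F s A ->
  (\int[P]_(w in A) lebesgue_measure (straddle (S^~ w) s t z r h) =
  \int[P \x lebesgue_measure]_(x in A `*` `]s, t]%classic)
     leap_prob P S h z r (S0 S x.2 x.1))%E.
Proof.
move=> s0 zr h0 FA; have mA := past_sub hS FA.
pose E := straddles z r h; have mE : measurable E by exact: measurable_straddles.
have mfE : measurable_fun setT (fun x : T * R => (\1_E x)%:E : \bar R).
  exact/measurable_EFinP/measurable_indic.
have fE0 (x : T * R) : (0 <= (\1_E x)%:E :> \bar R)%E by rewrite lee_fin.
transitivity (\int[P \x lebesgue_measure]_(x in A `*` `]s, t]%classic) (\1_E x)%:E)%E.
  rewrite ge0_integral_setX1//; apply: eq_integral => w _.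
  rewrite (_ : (fun y => (\1_E (w, y))%:E) = (fun y => (\1_(xsection E w) y)%:E)); last first.
    by apply/funext => y; rewrite !indicE mem_xsection.
  rewrite integral_indic//; last exact: measurable_xsection.
  by rewrite straddleE.
rewrite ge0_integral_setX2// [RHS]ge0_integral_setX2//; last 2 first.
- exact: measurable_leap_prob_path.
- by move=> x; exact: leap_prob_ge0.
apply: eq_integral => v; rewrite inE/= in_itv/= => /andP[sv vt].
have v0 : 0 <= v by rewrite (le_trans s0)// ltW.
rewrite (_ : (fun x => (\1_E (x, v))%:E) = (fun x => (\1_(ysection E v) x)%:E)); last first.
  by apply/funext => y; rewrite !indicE mem_ysection.
rewrite integral_indic//; last exact: measurable_ysection.
transitivity (\int[P]_(w in A) leap_prob P S h z r (S v w))%E; last first.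
  by apply: eq_integral => w _; rewrite S0E.
rewrite -(prob_straddle z r s0 (ltW sv) h0 FA).
rewrite setIC; congr (P _); apply/seteqP; split=> w /= [Aw].
  by move=> /ysectionP[/=]; rewrite !S0E ?addr_ge0.
by move=> [Sz rS]; split=> //; apply/ysectionP; rewrite /E /straddles/= !S0E// addr_ge0.
Qed.

(** By monotonicity such a path jumps over the whole of [z, r[ at a single time. *)
Definition leap (z r s t : R) : set T :=
  [set w | S s w < z] `&` [set w | r <= S t w] `\` hit S z r.

Lemma measurable_leap z r s t : 0 <= s -> 0 <= t -> measurable (leap z r s t).
Proof.
move=> s0 t0; apply: measurableD; last exact: (measurable_hit hS).
by apply: measurableI; [exact: (measurable_S_lt hS)|exact: (measurable_S_ge hS)].
Qed.

(** For each path the rescaled length of straddling times is at most [1] and is eventually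
    the indicator of the leap. *)
Lemma straddle_cvg A s t z r : 0 <= s -> s <= t -> z < r -> F s A ->
  (\int[P]_(w in A) ((2 ^+ m)%:E *
     lebesgue_measure (straddle (S^~ w) s t z r (mesh m))))%E @[m --> \oo] -->
  P (A `&` leap z r s t).
Proof.
move=> s0 st zr FA; have mA := past_sub hS FA.
have t0 : 0 <= t := le_trans s0 st.
rewrite (_ : P _ = (\int[P]_(w in A) (\1_(leap z r s t) w)%:E)%E); last first.
  have mL := measurable_leap z r s0 t0.
  by rewrite (integral_indic P mA mL) setIC.
have N0 m : 0 < 2 ^+ m :> R by rewrite exprn_gt0.
apply: (@bounded_convergence _ _ _ _ _ 1) => //.
- by rewrite -ge0_fin_numE// fin_num_measure.
- move=> m; apply: measurable_funTS; apply: emeasurable_funM => //.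
  by apply: measurable_straddle_length => //; exact/ltW/mesh_gt0.
- apply/measurable_EFinP/measurable_funTS/measurable_indic; exact: measurable_leap.
- by move=> m w Aw; rewrite mule_ge0// lee_fin ltW.
- move=> m w Aw.
  apply: (@le_trans _ _ ((2 ^+ m)%:E * (mesh m)%:E)%E).
    rewrite lee_pmul2l ?lte_fin//.
    by apply: (straddle_le (subordinator_path hS w)) => //; exact: mesh_gt0.
  by rewrite -EFinM divff// expf_neq0.
move=> w Aw; apply: cvg_near_cst.
have X := subordinator_path hS w.
have [Lw|nLw] := pselect (leap z r s t w).
  move: (Lw) => [[Sz rS] nh].
  have := straddle_jump X s0 zr st Sz rS nh.
  apply: filterS => m ->; rewrite indicE mem_set//= -EFinM divff// expf_neq0.
have : ~ [/\ S s w < z, r <= S t w & ~ hits (S^~ w) z r].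
  by move=> [? ? ?]; apply: nLw; split.
move=> /(straddle_nojump X s0 st).
by apply: filterS => m ->; rewrite indicE memNset//= measure0 mule0.
Qed.

(** Both sides are limits of the same expectations: pathwise by [straddle_cvg], and
    through the rates by [straddle_integral] and [rate_cvg].  The condition [z < r] is
    what dominates the rates: from below [z], reaching [r] takes a jump of size at least
    [r - z]. *)
Theorem leap_formula A s t z r : 0 <= s -> s <= t -> z < r -> F s A ->
  P (A `&` leap z r s t) =
  (\int[P \x lebesgue_measure]_(x in A `*` `]s, t]%classic)
     leap_rate Pi z r (S0 S x.2 x.1))%E.
Proof.
move=> s0 st zr FA; have mA := past_sub hS FA.
have h0 m : 0 <= mesh m :> R by exact/ltW/mesh_gt0.
have N0 m : 0 < 2 ^+ m :> R by rewrite exprn_gt0.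
have L := straddle_cvg s0 st zr FA.
suff : (\int[P]_(w in A) ((2 ^+ m)%:E *
     lebesgue_measure (straddle (S^~ w) s t z r (mesh m))))%E @[m --> \oo] -->
  (\int[P \x lebesgue_measure]_(x in A `*` `]s, t]%classic)
     leap_rate Pi z r (S0 S x.2 x.1))%E.
  exact: cvg_unique L.
have mAs : measurable (A `*` `]s, t]%classic) by exact: measurableX.
rewrite (_ : (fun m => _) = (fun m =>
  \int[P \x lebesgue_measure]_(x in A `*` `]s, t]%classic)
     ((2 ^+ m)%:E * leap_prob P S (mesh m) z r (S0 S x.2 x.1)))%E); last first.
  apply/funext => m; have N0e : (0 <= (2 ^+ m)%:E :> \bar R)%E by rewrite lee_fin ltW.
  rewrite (ge0_integralZl _ mA _ _ N0e)//; last first.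
    by apply: measurable_funTS; exact: measurable_straddle_length.
  rewrite straddle_integral//; apply/esym/ge0_integralZl => //.
  - by apply: measurable_funTS; exact: measurable_leap_prob_path.
  - by move=> x _; exact: leap_prob_ge0.
have rz0 : 0 < r - z by rewrite subr_gt0.
have [K [Kr KP]] := cvg_seq_bounded (cvgP _ (rate_cvg hS rz0)).
have {}KP m : 2 ^+ m * tail_law P S (r - z) (mesh m) <= K + 1.
  have := KP (K + 1); rewrite ltrDl => /(_ ltr01 m Logic.I).
  exact/le_trans/ler_norm.
have tail_law_le a b m : a <= b ->
    tail_law P S b (mesh m) <= tail_law P S a (mesh m).
  move=> ab; rewrite -lee_fin -!(tail_lawE hS)//.
  apply: le_measure; rewrite ?inE; [exact: (measurable_S_ge hS)..|].
  by move=> w /=; exact: le_trans.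
apply: (@bounded_convergence _ _ _ _ _ (K + 1)) => //.
- rewrite /= product_measure1E// lte_mul_pinfty// ?fin_num_measure//.
  by rewrite /= lebesgue_measure_itv/=; case: ifP => //; rewrite ltry.
- move=> m; apply: measurable_funTS; apply: emeasurable_funM => //.
  exact: measurable_leap_prob_path.
- by apply: measurable_funTS; exact: measurable_leap_rate_path.
- by move=> m x _; rewrite mule_ge0// ?leap_prob_ge0// lee_fin ltW.
- move=> m x _; apply: (@le_trans _ _ (2 ^+ m * tail_law P S (r - z) (mesh m))%:E).
    rewrite EFinM lee_pmul2l ?lte_fin// /leap_prob; case: ltP => Sz.
      by rewrite lee_fin tail_law_le// lerB// ltW.
    by rewrite lee_fin tail_law_ge0.
  by rewrite lee_fin.
- move=> x _; rewrite /leap_prob /leap_rate; case: ltP => Sz; last first.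
    by under eq_fun do rewrite mule0; exact: cvg_cst.
  have rS : 0 < r - S0 S x.2 x.1 by lra.
  rewrite (tailE hS)//; under eq_fun do rewrite -EFinM.
  by apply: cvg_EFin; [exact: nearW|exact: rate_cvg].
Qed.

End leaping.

Section leaping_limit.
Context {R : realType} {d : measure_display} {T : measurableType d}.
Variables (P : probability T R) (S : R -> T -> R).
Variable Pi : {sigma_finite_measure set R -> \bar R}.
Hypothesis hS : driftless_subordinator P S Pi.
Local Notation F := (natural_filtration S).

Lemma sub_leap z z' r s t : z <= z' -> leap S z r s t `<=` leap S z' r s t.
Proof.
move=> zz w [[Sz rS] nh]; split; first by split => //; exact: lt_le_trans zz.
by move=> h; apply: nh; exact: sub_hit h.
Qed.

(** The leaps over [z', r[ increase as [z'] increases to [z].  Unlike [leap_formula] this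
    allows [z = r], and for [z < r] it says that a leap a.s. starts from strictly below [z]. *)
Lemma leap_formula_left A s t z r : 0 <= s -> s <= t -> z <= r -> F s A ->
  P (A `&` \bigcup_n leap S (z - n.+1%:R^-1) r s t) =
  (\int[P \x lebesgue_measure]_(x in A `*` `]s, t]%classic)
     leap_rate Pi z r (S0 S x.2 x.1))%E.
Proof.
move=> s0 st zr FA; have mA := past_sub hS FA; have t0 := le_trans s0 st.
pose zn n := z - n.+1%:R^-1.
have znz n : zn n < z by rewrite ltrBlDr ltrDl.
have ndz m n : (m <= n)%N -> zn m <= zn n.
  by move=> mn; rewrite lerB// lef_pV2 ?posrE// ler_nat.
pose L n := A `&` leap S (zn n) r s t.
have mL n : measurable (L n) by apply: measurableI => //; exact: (measurable_leap hS).
have ndL : nondecreasing_seq L.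
  by move=> m n mn; apply/subsetPset; apply: setIS; apply: sub_leap; exact: ndz.
have cL := @nondecreasing_cvg_mu _ _ _ P L mL (bigcupT_measurable L mL) ndL.
rewrite setI_bigcupr; apply: (cvg_unique _ cL).
  exact: ereal_hausdorff.
rewrite (_ : P \o L = (fun n =>
  \int[P \x lebesgue_measure]_(x in A `*` `]s, t]%classic)
     leap_rate Pi (zn n) r (S0 S x.2 x.1))%E); last first.
  apply/funext => n /=; apply: (leap_formula hS) => //.
  exact: lt_le_trans zr.
rewrite (_ : (\int[_]_(x in _) leap_rate Pi z r _)%E =
  (\int[P \x lebesgue_measure]_(x in A `*` `]s, t]%classic)
    limn (fun n => leap_rate Pi (zn n) r (S0 S x.2 x.1)))%E); last first.
  apply: eq_integral => x _; apply/esym/cvg_lim => //.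
  apply: cvg_near_cst; rewrite /leap_rate; case: ltP => Sz.
    have [n Sn] := ltr_add_invr Sz; exists n => // m /= nm.
    by rewrite ifT// (lt_le_trans _ (ndz _ _ nm))// ltrBrDr.
  by apply: nearW => n; rewrite ltNge (le_trans (ltW (znz n))).
apply: cvg_monotone_convergence => //.
- exact: measurableX.
- move=> n; apply: measurable_funTS; exact: (measurable_leap_rate_path hS).
- by move=> n x _; exact: leap_rate_ge0.
- move=> x _ m n mn; rewrite /leap_rate; case: (ltP _ (zn m)) => Sm.
    by rewrite ifT// (lt_le_trans Sm)// ndz.
  by case: ifP.
Qed.

Lemma leap_cup r s t : \bigcup_n leap S (r - n.+1%:R^-1) r s t =
  [set w | S s w < r] `&` [set w | r <= S t w] `\` creep S r.
Proof.
apply/seteqP; split=> w /=.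
  move=> [n _ [[Sz rS] nh]]; split; first by split=> //; rewrite (lt_le_trans Sz)// gerBl invr_ge0.
  by move=> cr; apply: nh; apply: cr; rewrite ltrBlDr ltrDl.
move=> [[Sr rS] ncr].
have [z [zr nh]] : exists z, z < r /\ ~ hits (S^~ w) z r.
  apply: contrapT => H; apply: ncr => z zr; apply: contrapT => nh.
  by apply: H; exists z.
have : Num.max z (S s w) < r by rewrite gt_max zr.
move=> /ltr_add_invr[n]; rewrite -ltrBrDr gt_max => /andP[zn Sn].
exists n => //; split; first by split.
by move=> h; apply: nh; apply: sub_hit h => //; exact: ltW.
Qed.

Lemma creep_formula A s t r : 0 <= s -> s <= t -> F s A ->
  P (A `&` ([set w | S s w < r] `&` [set w | r <= S t w] `\` creep S r)) =
  (\int[P \x lebesgue_measure]_(x in A `*` `]s, t]%classic)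
     leap_rate Pi r r (S0 S x.2 x.1))%E.
Proof. by move=> s0 st FA; rewrite -leap_cup leap_formula_left. Qed.

(** The probability is at most [exp (- t Pi [a, +oo[)]. *)
Lemma prob_below_vanish a : 0 < tail Pi a -> 0 < a -> forall e, 0 < e ->
  exists2 t, 0 <= t & (P [set w | (S t w < a)%R] <= e%:E)%E.
Proof.
move=> T0 a0 e e0; exists ((e * tail Pi a)^-1).
  by rewrite invr_ge0 mulr_ge0 ?ltW.
apply: le_trans (prob_below_le hS a0 _) _.
  by rewrite invr_ge0 mulr_ge0 ?ltW.
rewrite lee_fin invfM mulfVK ?gt_eqF// expRN invf_ple ?posrE ?expR_gt0//.
by apply: le_trans (expR_ge1Dx _); rewrite lerDr.
Qed.

Lemma past_setT s : F s setT.
Proof. by rewrite measurable_past. Qed.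

(** A path creeping up to [x] that misses [x, x + eta[ leaps over it, but leaps over no
    [z', x + eta[ with [z' < x].  By [leap_formula] and [leap_formula_left] these two
    kinds of leaps have the same probability. *)
Lemma creep_hit_right x eta : 0 < x -> 0 < eta -> 0 < tail Pi (x + eta) ->
  P (creep S x `\` hit S x (x + eta)) = 0%E.
Proof.
move=> x0 eta0 T0; have xe0 : 0 < x + eta by rewrite addr_gt0.
have mC : measurable (creep S x `\` hit S x (x + eta)).
  by apply: measurableD; [exact: (measurable_creep hS)|exact: (measurable_hit hS)].
apply/eqP; rewrite eq_le measure_ge0 andbT; apply/lee_addgt0Pr => e e0.
rewrite add0e; have [t t0 tP] := prob_below_vanish T0 xe0 e0.
have L1 := leap_formula hS (lexx 0) t0 (ltr_pwDr eta0 (lexx x)) (@past_setT 0).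
have L2 := leap_formula_left (lexx 0) t0 (ltW (ltr_pwDr eta0 (lexx x))) (@past_setT 0).
have mU : measurable (\bigcup_n leap S (x - n.+1%:R^-1) (x + eta) 0 t).
  by apply: bigcupT_measurable => n; exact: (measurable_leap hS).
have mL : measurable (leap S x (x + eta) 0 t) by exact: (measurable_leap hS).
have LU : P (leap S x (x + eta) 0 t) =
    P (\bigcup_n leap S (x - n.+1%:R^-1) (x + eta) 0 t).
  by rewrite !setTI in L1 L2; rewrite L1 -L2.
have D0 : P (leap S x (x + eta) 0 t `\`
    \bigcup_n leap S (x - n.+1%:R^-1) (x + eta) 0 t) = 0%E.
  apply: eq_trans (measureD mL mU _) _; first by rewrite -ge0_fin_numE// fin_num_measure.
  rewrite setIidr; last first.
    by apply: bigcup_sub => n _; apply: sub_leap; rewrite gerBl invr_ge0.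
  by apply: eq_trans (subee _); [congr (_ - _)%E|exact: fin_num_measure].
apply: le_trans tP; rewrite -[leRHS]add0e -D0.
have mB := measurable_S_lt hS (x + eta) t0; have mLU := measurableD mL mU.
apply: le_trans (measureU2 P mLU mB).
apply: le_measure; rewrite ?inE//; first exact: measurableU.
move=> w [cx nh]; have [xS|Sx] := leP (x + eta) (S t w); [left|by right].
split; first by split => //; split => //=; rewrite (sub_0 hS).
move=> [n _ [_ nh']]; apply: nh'; have /cx : x - n.+1%:R^-1 < x by rewrite ltrBlDr ltrDl.
by apply: sub_hit => //; rewrite lerDl ltW.
Qed.

End leaping_limit.

(** * Creeping after a restart of the process *)

Section restarting.
Context {R : realType} {d : measure_display} {T : measurableType d}.
Variables (P : probability T R) (S : R -> T -> R).
Variable Pi : {sigma_finite_measure set R -> \bar R}.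
Hypothesis hS : driftless_subordinator P S Pi.
Local Notation F := (natural_filtration S).

Lemma leap_rateD r a b : leap_rate Pi r r (a + b) = leap_rate Pi (r - a) (r - a) b.
Proof. by rewrite /leap_rate ltrBrDl opprD addrA. Qed.

(** The rate at the levels reached after [s] is that of an independent copy of the process
    for the remaining distance [r - S_s]. *)
Lemma creep_formula_shift A s t r : 0 <= s -> 0 <= t -> F s A ->
  P (A `&` ([set w | S s w < r] `&` [set w | r <= S (s + t) w] `\` creep S r)) =
  (\int[P]_(w in A) \int[P \x lebesgue_measure]_(x in setT `*` `]0%R, t]%classic)
     leap_rate Pi (r - S s w) (r - S s w) (S0 S x.2 x.1))%E.
Proof.
move=> s0 t0 FA; have mA := past_sub hS FA.
rewrite (creep_formula hS)// ?lerDl//.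
rewrite ge0_integral_setX2//; last 2 first.
- exact: (measurable_leap_rate_path hS).
- by move=> x; exact: leap_rate_ge0.
rewrite ge0_integral_shift//; last 2 first.
- apply: (measurable_integral_fst P (f := fun x => leap_rate Pi r r (S0 S x.2 x.1))) => //.
    exact: (measurable_leap_rate_path hS).
  by move=> x; exact: leap_rate_ge0.
- by move=> v; apply: integral_ge0 => w _; exact: leap_rate_ge0.
pose K (x : T * R) : \bar R :=
  (\int[P]_w' leap_rate Pi r r (S s x.1 + S0 S x.2 w')%R)%E.
have mSs : measurable_fun setT (S s) := sub_meas hS s0.
have mK : measurable_fun setT K.
  pose k (y : (T * R) * T) : \bar R :=
    leap_rate Pi r r (S s y.1.1 + S0 S y.1.2 y.2).
  have mk : measurable_fun setT k.
    apply: (measurableT_comp (measurable_leap_rate Pi r r)).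
    apply: measurable_funD.
      by apply: (measurableT_comp mSs); exact: measurableT_comp.
    apply: (measurableT_comp (measurable_S0 hS) (g := fun y : (T * R) * T => (y.2, y.1.2))).
    by apply: measurable_fun_pair => //; exact: measurableT_comp.
  have k0 y : (0 <= k y)%E by exact: leap_rate_ge0.
  exact: (@measurable_fun_fubini_tonelli_F _ _ _ _ _ P k mk k0).
have K0 x : (0 <= K x)%E by apply: integral_ge0 => w _; exact: leap_rate_ge0.
transitivity (\int[lebesgue_measure]_(u in `]0%R, t]) \int[P]_(w in A) K (w, u))%E.
  apply: eq_integral => u; rewrite inE/= in_itv/= => /andP[u0 ut].
  have us : 0 <= s + u by rewrite addr_ge0// ltW.
  pose phi (z : past S s * R) : \bar R :=
    ((\1_A (z.1 : T))%:E * leap_rate Pi r r (S s z.1 + z.2)%R)%E.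
  have mphi : measurable_fun setT phi.
    apply: emeasurable_funM.
      apply/measurable_EFinP.
      apply: (measurableT_comp (f := \1_(A : set (past S s)) : past S s -> R)) => //.
    apply: (measurableT_comp (measurable_leap_rate Pi r r)).
    apply: measurable_funD => //.
    by apply: (measurableT_comp (past_value _)) => //; rewrite s0 lexx.
  have phi0 z : (0 <= phi z)%E.
    by rewrite /phi mule_ge0// ?lee_fin// leap_rate_ge0.
  have := increments_markov hS s0 (ltW u0) mphi phi0; rewrite /phi/= => E.
  rewrite integral_mkcond [RHS]integral_mkcond; apply: eq_trans (eq_trans _ E) _.
    by apply: eq_integral => w _; rewrite patchE indicE; case: ifP => _;
       rewrite ?mul1e ?mul0e// /= S0E// subrKC.
  apply: eq_integral => w _; rewrite patchE indicE; case: ifP => _.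
    by apply: eq_integral => w' _; rewrite mul1e /K /= S0E ?(ltW u0).
  by apply: integral0_eq => w' _; rewrite mul0e.
rewrite -ge0_integral_setX2// ge0_integral_setX1//.
apply: eq_integral => w _.
rewrite [RHS](ge0_integral_setX2 P lebesgue_measure
  (f := fun x : T * R => leap_rate Pi (r - S s w) (r - S s w) (S0 S x.2 x.1))
  measurableT (measurable_itv _)); last 2 first.
- exact: (measurable_leap_rate_path hS).
- by move=> x; exact: leap_rate_ge0.
apply: eq_integral => u _; apply: eq_integral => w' _.
by rewrite /= leap_rateD.
Qed.

End restarting.

Section creep_markov_property.
Context {R : realType} {d : measure_display} {T : measurableType d}.
Variables (P : probability T R) (S : R -> T -> R).
Variable Pi : {sigma_finite_measure set R -> \bar R}.
Hypothesis hS : driftless_subordinator P S Pi.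
Local Notation F := (natural_filtration S).

Definition creep_prob (r : R) : R := fine (P (creep S r)).

Lemma creep_probE r : P (creep S r) = (creep_prob r)%:E.
Proof. by rewrite fineK// fin_num_measure//; exact: (measurable_creep hS). Qed.

Lemma creep_prob_ge0 r : 0 <= creep_prob r.
Proof. exact/fine_ge0/measure_ge0. Qed.

Lemma creep_prob_le1 r : creep_prob r <= 1.
Proof.
by rewrite -lee_fin -creep_probE probability_le1//; exact: (measurable_creep hS).
Qed.

(** Passage of the level [r] before [t] other than by creeping: for this event, and not for
    [creep r], the formulas above express the probability through the rates. *)
Definition cross (r t : R) : set T :=
  [set w | S 0 w < r] `&` [set w | r <= S t w] `\` creep S r.

Lemma measurable_cross r t : 0 <= t -> measurable (cross r t).
Proof.
move=> t0; apply: measurableD; last exact: (measurable_creep hS).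
by apply: measurableI; [exact: (measurable_S_lt hS)|exact: (measurable_S_ge hS)].
Qed.

Lemma prob_cross_ge r t a e : 0 < r -> r <= a -> 0 <= t ->
  (P [set w | (S t w < a)%R] <= e%:E)%E ->
  ((1 - creep_prob r - e)%:E <= P (cross r t))%E.
Proof.
move=> r0 ra t0 Pe; have mc := measurable_creep hS r.
have mx := measurable_cross r t0; have mb := measurable_S_lt hS a t0.
have : (P setT <= P (cross r t) + (P (creep S r) + P [set w | (S t w < a)%R]))%E.
  apply: (@le_trans _ _ (P (cross r t `|` (creep S r `|` [set w | (S t w < a)%R])))).
    apply: le_measure; rewrite ?inE//.
      by apply: measurableU => //; exact: measurableU.
    move=> w _; have [cw|ncw] := pselect (creep S r w); first by right; left.
    have [Sa|aS] := ltP (S t w) a; first by right; right.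
    left; split => //; split; first by rewrite /= (sub_0 hS).
    exact: le_trans aS.
  apply: le_trans (measureU2 _ mx (measurableU _ _ mc mb)) _.
  by apply: leeD => //; exact: measureU2.
rewrite probability_setT creep_probE -[P (cross r t)]fineK ?fin_num_measure// => H.
have : (1%:E <= (fine (P (cross r t)))%:E + ((creep_prob r)%:E + e%:E))%E.
  by apply: le_trans H _; rewrite leeD2l// leeD2l.
by rewrite !lee_fin; lra.
Qed.

(** The Markov property for creeping.  It is derived for the complementary event, to which
    [creep_formula_shift] applies: after [s] the level [r] is passed without creeping
    with probability at least [1 - c], up to the small probability that it is not passed
    at all within a long time; the positive tail at [a >= r - S_s] makes the latter vanish. *)
Lemma creep_markov A s r c a : 0 <= s -> F s A -> 0 < a -> 0 < tail Pi a ->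
  0 <= c ->
  (forall w, A w -> S s w < r /\ r - S s w <= a /\ creep_prob (r - S s w) <= c) ->
  (P (A `&` creep S r) <= c%:E * P A)%E.
Proof.
move=> s0 FA a0 T0 c0 AH; have mA := past_sub hS FA.
apply/lee_addgt0Pr => e e0; have [t t0 tP] := prob_below_vanish hS T0 a0 e0.
pose E := [set w | S s w < r] `&` [set w | r <= S (s + t) w] `\` creep S r.
have mc := measurable_creep hS r.
have mE : measurable E.
  apply: measurableD => //; apply: measurableI; first exact: (measurable_S_lt hS).
  by apply: (measurable_S_ge hS); rewrite addr_ge0.
pose B : set (T * T) := [set x | S 0 x.2 < r - S s x.1] `&`
  [set x | r - S s x.1 <= S t x.2] `\`
  ((fun x : T * T => (r - S s x.1, x.2)) @^-1` [set x | creep S x.1 x.2]).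
have mSs : measurable_fun setT (fun x : T * T => r - S s x.1).
  by apply: measurable_funB => //; exact: (measurableT_comp (sub_meas hS s0)).
have mB : measurable B.
  apply: measurableD.
    apply: measurableI.
      by apply: measurable_lt_set => //; exact: (measurableT_comp (sub_meas hS _)).
    by apply: measurable_le_set => //; exact: (measurableT_comp (sub_meas hS _)).
  rewrite -[X in measurable X]setTI.
  apply: (measurable_fun_pair mSs measurable_snd) => //.
  exact: (measurable_creep_joint hS).
have PE : P (A `&` E) = (\int[P]_(w in A) P (xsection B w))%E.
  rewrite (creep_formula_shift hS)//; apply: eq_integral => w; rewrite inE => Aw.
  rewrite -(creep_formula hS _ (lexx 0) t0 (@past_setT _ _ _ S 0)) setTI.
  congr (P _); apply/seteqP; split=> w'; first by move=> [[? ?] ?]; apply/xsectionP.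
  by move=> /xsectionP.
(* [P (xsection B w)] is the probability that a copy of the process crosses
   [r - S s w] without creeping before [t]. *)
have low : ((1 - c - e)%:E * P A <= P (A `&` E))%E.
  have [ce|ce] := leP 0 (1 - c - e); last first.
    apply: (@le_trans _ _ 0%E) => //.
    by rewrite mule_le0_ge0// lee_fin ltW.
  rewrite PE -integral_cst//; apply: ge0_le_integral => //.
  - by apply: measurable_funTS; exact: measurable_fun_xsection.
  - move=> w Aw; have [Sr [ra cp]] := AH w Aw.
    apply: (@le_trans _ _ (1 - creep_prob (r - S s w) - e)%:E).
      by rewrite lee_fin; lra.
    apply: le_trans (prob_cross_ge _ ra t0 tP) _; first by rewrite subr_gt0.
    apply: le_measure; rewrite ?inE; [exact: measurable_cross|exact: measurable_xsection|].
    by move=> w' [[? ?] ?]; apply/xsectionP.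
have add : (P (A `&` creep S r) + P (A `&` E) <= P A)%E.
  rewrite -measureU; [|exact: measurableI|exact: measurableI|].
    apply: le_measure; rewrite ?inE//.
      by apply: measurableU; exact: measurableI.
    by move=> w [[]|[]].
  by apply/seteqP; split=> // w [[_ ?] [_ [_ ?]]].
move: low add; have fP X : measurable X -> P X = (fine (P X))%:E.
  by move=> mX; rewrite fineK// fin_num_measure.
have Ple1 : (P A <= 1)%E by exact: probability_le1.
have P0 : (0 <= P A)%E by [].
rewrite (fP A)// (fP (A `&` E)); last exact: measurableI.
rewrite (fP (A `&` creep S r)); last exact: measurableI.
move: Ple1 P0; rewrite (fP A)// -!EFinM -!EFinD !lee_fin; nra.
Qed.

End creep_markov_property.

Section creep_after_first_entry.
Context {R : realType} {d : measure_display} {T : measurableType d}.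
Variables (P : probability T R) (S : R -> T -> R).
Variable Pi : {sigma_finite_measure set R -> \bar R}.
Hypothesis hS : driftless_subordinator P S Pi.
Local Notation F := (natural_filtration S).

(** The bound [w] limits the overshoot above [z] at the end of the cell, where the process
    is restarted. *)
Definition first_entry (z w : R) (m k : nat) : set T :=
  [set x | S (dyadic m k) x < z] `&`
  ([set x | z <= S (dyadic m k.+1) x] `&` [set x | S (dyadic m k.+1) x < w]).

Lemma past_S_ge u t z : 0 <= u <= t -> F t [set x | z <= S u x].
Proof.
move=> /andP[u0 ut]; rewrite measurable_past.
by apply: measurable_le_set => //; apply: past_value; rewrite u0.
Qed.

Lemma past_S_lt u t z : 0 <= u <= t -> F t [set x | S u x < z].
Proof.
move=> /andP[u0 ut]; rewrite measurable_past.
by apply: measurable_lt_set => //; apply: past_value; rewrite u0.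
Qed.

Lemma pastI t A B : F t A -> F t B -> F t (A `&` B).
Proof. by rewrite !measurable_past; exact: measurableI. Qed.

(** The event [A0] need only be known once [z] has been passed, as for [creep z]. *)
Lemma past_first_entry z w m k A0 :
  (forall t, 0 <= t -> F t (A0 `&` [set x | z <= S t x])) ->
  F (dyadic m k.+1) (A0 `&` first_entry z w m k).
Proof.
move=> A0z; rewrite /first_entry setIA (setIC A0) -setIA (setIA A0).
apply: pastI; first by apply: past_S_lt; rewrite dyadic_ge0 dyadic_le.
apply: pastI; first by apply: A0z; exact: dyadic_ge0.
by apply: past_S_lt; rewrite dyadic_ge0 lexx.
Qed.

Lemma first_entry_disjoint z w m : trivIset setT (first_entry z w m).
Proof.
move=> i j _ _ [x [[/= ziS [ziz _]] [/= zj [zjz _]]]].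
have X := subordinator_path hS x.
apply/eqP; case: ltngtP => // ij.
  have : S (dyadic m i.+1) x <= S (dyadic m j) x.
    by apply: (path_homo X); [exact: dyadic_ge0|exact: dyadic_le].
  by rewrite leNgt (lt_le_trans zj).
have : S (dyadic m j.+1) x <= S (dyadic m i) x.
  by apply: (path_homo X); [exact: dyadic_ge0|exact: dyadic_le].
by rewrite leNgt (lt_le_trans ziS).
Qed.

Lemma first_entry_cup z w m : 0 < z -> \bigcup_k first_entry z w m k =
  \bigcup_k [set x | z <= S (dyadic m k) x < w].
Proof.
move=> z0; apply/seteqP; split=> x.
  by move=> [k _ [_ [/= ? ?]]]; exists k.+1 => //=; apply/andP.
move=> [k _ /= /andP[zS Sw]].
have X := subordinator_path hS x.
have exk : exists j, z <= S (dyadic m j) x by exists k.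
have := ex_minnP exk => -[[|j] zj jmin].
  by move: zj; rewrite dyadic0 (sub_0 hS) leNgt z0.
exists j => //; split; last split => //=.
  by rewrite /= ltNge; apply/negP => /jmin; rewrite ltnn.
apply: le_lt_trans Sw; apply: (path_homo X); first exact: dyadic_ge0.
exact/dyadic_le/jmin.
Qed.

(** A strong Markov property at the first dyadic time spent in [z, w[: the Markov property
    applies on each of the disjoint events of first entry, whose union increases to the
    event of hitting [z, w[ as the mesh is refined. *)
Lemma creep_after_hit A0 z w r c a : 0 < z -> w <= r -> measurable A0 ->
  (forall t, 0 <= t -> F t (A0 `&` [set x | z <= S t x])) ->
  0 < a -> 0 < tail Pi a -> r - z <= a -> 0 <= c ->
  (forall y, z <= y < w -> creep_prob P S (r - y) <= c) ->
  (P (A0 `&` hit S z w `&` creep S r) <= c%:E * P (A0 `&` hit S z w))%E.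
Proof.
move=> z0 wr mA0 A0z a0 T0 rza c0 cP; have mc := measurable_creep hS r.
pose H m := A0 `&` \bigcup_k first_entry z w m k.
have mE m k : measurable (A0 `&` first_entry z w m k).
  exact: (past_sub hS (@past_first_entry z w m k A0 A0z)).
have HE m : H m = \bigcup_k (A0 `&` first_entry z w m k) by rewrite /H setI_bigcupr.
have mH m : measurable (H m) by rewrite HE; exact: bigcupT_measurable.
have mHc m : measurable (H m `&` creep S r) by exact: measurableI.
have step m : (P (H m `&` creep S r) <= c%:E * P (H m))%E.
  rewrite HE setI_bigcupl.
  have tE : trivIset setT (fun k => A0 `&` first_entry z w m k).
    exact/trivIset_setIl/first_entry_disjoint.
  rewrite !measure_bigcup//; last 2 first.
  - by move=> k _; exact: measurableI.
  - exact: trivIset_setIr.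
  rewrite -nneseriesZl//; apply: lee_nneseries => // k _.
  apply: (creep_markov hS _ (@past_first_entry z w m k A0 A0z) a0 T0) => //.
    exact: dyadic_ge0.
  move=> x [_ [_ [/= zS Sw]]]; split; first exact: lt_le_trans wr.
  split; last by apply: cP; rewrite zS.
  by apply: le_trans rza; rewrite lerB.
have ndH : nondecreasing_seq H.
  apply/nondecreasing_seqP => m; apply/subsetPset; apply: setIS.
  rewrite !first_entry_cup// => x [k _ zw]; exists k.*2 => //.
  by rewrite /= dyadic_refine.
have UH : \bigcup_m H m = A0 `&` hit S z w.
  rewrite (hitE hS) /H -setI_bigcupr; congr (_ `&` _).
  by apply: eq_bigcupr => m _; rewrite first_entry_cup.
have cv1 := @nondecreasing_cvg_mu _ _ _ P _ mH (bigcupT_measurable H mH) ndH.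
have ndHc : nondecreasing_seq (fun m => H m `&` creep S r).
  by move=> i j ij; apply/subsetPset; apply: setSI; exact/subsetPset/ndH.
have cv2 := @nondecreasing_cvg_mu _ _ _ P _ mHc (bigcupT_measurable _ mHc) ndHc.
rewrite -setI_bigcupl UH in cv2; rewrite UH in cv1.
have cv3 := @cvgeZl _ _ _ _ _ c%:E isT cv1.
exact: (lee_cvg_to cv2 cv3 (nearW _ step)).
Qed.

End creep_after_first_entry.

(** * No level is approached continuously *)

Section no_creeping.
Context {R : realType} {d : measure_display} {T : measurableType d}.
Variables (P : probability T R) (S : R -> T -> R).
Variable Pi : {sigma_finite_measure set R -> \bar R}.
Hypothesis hS : driftless_subordinator P S Pi.
Local Notation F := (natural_filtration S).

Local Notation p := (creep_prob P S).

Lemma tail_le a b : 0 < a -> a <= b -> tail Pi b <= tail Pi a.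
Proof.
move=> a0 ab; rewrite -lee_fin -!(tailE hS)//; last exact: lt_le_trans ab.
apply: le_measure; rewrite ?inE//; try exact: measurable_itv.
by move=> x /=; rewrite !in_itv/= !andbT; exact: le_trans.
Qed.

Lemma hit_cvg_creep y :
  fine (P (hit S (y - n.+1%:R^-1) y)) @[n --> \oo] --> p y.
Proof.
have mH n : measurable (hit S (y - n.+1%:R^-1) y) by exact: (measurable_hit hS).
have mI : measurable (\bigcap_n hit S (y - n.+1%:R^-1) y).
  by rewrite -creepE; exact: (measurable_creep hS).
have niH : nonincreasing_seq (fun n => hit S (y - n.+1%:R^-1) y).
  move=> m n mn; apply/subsetPset; apply: sub_hit => //.
  by rewrite lerB// lef_pV2 ?posrE// ler_nat.
have := @nonincreasing_cvg_mu _ _ _ P _ _ mH mI niH; rewrite -creepE => H.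
apply: fine_cvg; rewrite -(creep_probE hS).
by apply: H; rewrite -ge0_fin_numE// fin_num_measure.
Qed.

(** Creeping up to a level [y'] in ]y - eta, y[ entails a visit to [y - eta, y[, and the
    probability of such a visit decreases to [p y]. *)
Lemma creep_prob_usc y k :
  (forall eta, 0 < eta -> exists2 y', y - eta < y' < y & k <= p y') -> k <= p y.
Proof.
move=> H; apply: (cvgr_to_ge (hit_cvg_creep (y := y))).
apply: nearW => n; have [|y' /andP[ny' y'y] ky'] := H n.+1%:R^-1; first by [].
apply: (le_trans ky'); rewrite -lee_fin -(creep_probE hS) fineK; last first.
  by rewrite fin_num_measure//; exact: (measurable_hit hS).
apply: le_measure; rewrite ?inE.
- exact: (measurable_creep hS).
- exact: (measurable_hit hS).
- by move=> w cw; apply: sub_hit (creep_hit ny' cw) => //; exact: ltW.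
Qed.

(** Once [x] has been passed, all dyadic times that see a visit to [x - q, x[ lie before [t]. *)
Lemma past_creep x t : 0 <= t -> F t (creep S x `&` [set w | x <= S t w]).
Proof.
move=> t0; rewrite measurable_past.
rewrite (_ : _ `&` _ = \bigcap_n \bigcup_m \bigcup_(k in [set k | dyadic m k <= t])
    ([set w | x - n.+1%:R^-1 <= S (dyadic m k) w] `&`
     ([set w | S (dyadic m k) w < x] `&` [set w | x <= S t w]))).
  apply: bigcapT_measurable => n; apply: bigcupT_measurable => m.
  apply: bigcup_measurable => k /= kt.
  have k0 := @dyadic_ge0 R m k.
  apply: measurableI; first by rewrite -measurable_past; apply: past_S_ge; rewrite k0.
  apply: measurableI; rewrite -measurable_past; first by apply: past_S_lt; rewrite k0.
  by apply: past_S_ge; rewrite t0 lexx.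
apply/seteqP; split=> w.
  move=> [cx xt] n _.
  have : hit S (x - n.+1%:R^-1) x w by apply: creep_hit cx; rewrite ltrBlDr ltrDl.
  rewrite (hitE hS) => -[m _ [k _ /= /andP[xk kx]]]; exists m => //; exists k => //=.
  apply/ltW/(path_ltW (subordinator_path hS w)) => //.
  exact: lt_le_trans xt.
move=> H; split; last by have [m _ [k _ [_ [_]]]] := H 0%N Logic.I.
rewrite creepE => n _; have [m _ [k _ [xk [kx _]]]] := H n Logic.I.
by rewrite (hitE hS); exists m => //; exists k => //=; apply/andP.
Qed.

(** To creep up to [x + y] without having crept up to [x] has probability at most
    [1 - p x].  A path that creeps up to [x] a.s. visits every interval [x, x + eta[, and
    from there creeps up to [x + y] with probability about [p y] at most, by
    [creep_prob_usc]. *)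
Lemma creep_prob_step x y a : 0 < x -> 0 < y -> x + y <= a -> 0 < tail Pi a ->
  p (x + y) <= p x * p y + (1 - p x).
Proof.
move=> x0 y0 xya T0; have a0 : 0 < a by lra.
have px0 := creep_prob_ge0 P S x.
have mx := measurable_creep hS x; have mxy := measurable_creep hS (x + y).
apply/ler_addgt0Pr => e e0.
have [eta eta0 pk] : exists2 eta, 0 < eta & forall y', y - eta < y' <= y -> p y' <= p y + e.
  apply: contrapT => H; suff : p y + e <= p y by rewrite gerDl leNgt e0.
  apply: creep_prob_usc => eta eta0; apply: contrapT => H'; apply: H.
  exists eta => // y' /andP[yy']; rewrite le_eqVlt => /predU1P[->|y'y].
    by rewrite lerDl ltW.
  rewrite leNgt; apply/negP => py; apply: H'; exists y'; first by rewrite yy'.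
  exact: ltW.
pose eta' := Num.min eta y.
have eta'0 : 0 < eta' by rewrite lt_min eta0.
have ey : eta' <= y by rewrite ge_min lexx orbT.
have T1 : 0 < tail Pi (x + eta').
  by apply: lt_le_trans T0 _; apply: tail_le; lra.
have N0 := creep_hit_right hS x0 eta'0 T1.
have mh := measurable_hit hS x (x + eta').
have HIT := @creep_after_hit _ _ _ _ _ _ hS (creep S x) x (x + eta') (x + y) (p y + e) a.
have {}HIT : (P (creep S x `&` hit S x (x + eta') `&` creep S (x + y)) <=
    (p y + e)%:E * P (creep S x `&` hit S x (x + eta')))%E.
  apply: HIT => //.
  - by rewrite lerD2l.
  - by exact: past_creep.
  - by rewrite addrC addKr; lra.
  - by rewrite addr_ge0 ?creep_prob_ge0// ltW.
  - have : eta' <= eta by rewrite ge_min lexx.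
    by move=> ee v /andP[xv vx]; apply: pk; apply/andP; split; lra.
have mI := measurableI _ _ mx mxy.
have E1 : (P (creep S (x + y)) <= P (creep S x `&` creep S (x + y)) + P (~` creep S x))%E.
  apply: le_trans (measureU2 P mI (measurableC mx)).
  apply: le_measure; rewrite ?inE//; first by apply: measurableU => //; exact: measurableC.
  by move=> w cw; have [?|?] := pselect (creep S x w); [left|right].
have E2 : (P (creep S x `&` creep S (x + y)) <= (p y + e)%:E * (p x)%:E)%E.
  have mA := measurableD mx mh; have mB := measurableI _ _ (measurableI _ _ mx mh) mxy.
  apply: (@le_trans _ _ (P (creep S x `\` hit S x (x + eta') `|`
      creep S x `&` hit S x (x + eta') `&` creep S (x + y)))).
    apply: le_measure; rewrite ?inE//; first exact: measurableU.
    move=> w [cx cxy]; have [h|h] := pselect (hit S x (x + eta') w).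
      by right.
    by left.
  apply: le_trans (measureU2 P mA mB) _.
  rewrite [X in (X + _ <= _)%E](_ : _ = 0%E) ?add0e//.
  apply: (le_trans HIT); rewrite lee_pmul2l// ?lte_fin; last first.
    by rewrite ltr_wpDl ?creep_prob_ge0.
  rewrite -(creep_probE hS); apply: le_measure; rewrite ?inE//.
  exact: measurableI.
have : ((p (x + y))%:E <= (p y + e)%:E * (p x)%:E + (1 - p x)%:E)%E.
  rewrite -(creep_probE hS); apply: (le_trans E1); apply: leeD => //.
  by rewrite probability_setC// (creep_probE hS).
rewrite -EFinM -EFinD lee_fin => /le_trans; apply.
have := creep_prob_le1 hS x; nra.
Qed.

(** If [p <= c] on ]0, e[, then by [creep_after_hit] creeping up to [r] has probability at
    most [c] times that of a visit to [r - q, r[, for small [q]; this tends to [c * p r]. *)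
Lemma creep_prob_near1 r a c : 0 < r -> 0 < a -> 0 < tail Pi a -> 0 <= c -> c < 1 ->
  0 < p r -> forall e, 0 < e -> exists2 h, 0 < h < e & c < p h.
Proof.
move=> r0 a0 T0 c0 c1 pr e e0; apply: contrapT => nh.
have mc := measurable_creep hS r.
suff : p r <= c * p r by rewrite ler_pMl// leNgt c1.
apply: (ler_cvg_to (cvg_cst _) (cvgMr (hit_cvg_creep (y := r)))).
have m0 : 0 < Num.min r (Num.min a e) by rewrite !lt_min r0 a0.
have [n0 /= n0m] : exists n, 0 + n.+1%:R^-1 < Num.min r (Num.min a e).
  exact: ltr_add_invr.
exists n0 => // n /= n0n.
have {n0m} : n.+1%:R^-1 < Num.min r (Num.min a e).
  by rewrite add0r in n0m; apply: le_lt_trans n0m; rewrite lef_pV2 ?posrE// ler_nat.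
rewrite !lt_min => /and3P[].
have q0 : 0 < n.+1%:R^-1 :> R by [].
move: (n.+1%:R^-1) q0 => q q0 qr qa qe.
pose z := r - q; have zr : z < r by rewrite ltrBlDr ltrDl.
have mh := measurable_hit hS z r.
have := @creep_after_hit _ _ _ _ _ _ hS setT z r r c a.
rewrite setTI => H.
have {}H : (P (hit S z r `&` creep S r) <= c%:E * P (hit S z r))%E.
  apply: H => //.
  - by rewrite subr_gt0.
  - by move=> t t0; rewrite setTI; apply: past_S_ge; rewrite t0 lexx.
  - by rewrite subKr ltW.
  - move=> v /andP[zv vr]; rewrite leNgt; apply/negP => cp; apply: nh.
    by exists (r - v) => //; move: zv; rewrite /z => zv; apply/andP; split; lra.
rewrite -lee_fin EFinM /= !fineK ?fin_num_measure//; apply: le_trans H.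
by rewrite setIidr//; exact: creep_hit.
Qed.

(** By [creeps_null] and Tonelli's theorem, for almost every level [y] the process a.s. does
    not creep up to [y] before [t].  If [p] were at least [1/2] on ]0, e[, the creeping
    would have to take place after [t], which is unlikely when [t] is large. *)
Lemma creep_prob_small a e : 0 < a -> 0 < tail Pi a -> 0 < e -> e <= a ->
  exists2 y, 0 < y < e & p y < 2^-1.
Proof.
move=> a0 T0 e0 ea; apply: contrapT => ny.
have [t t0 Pt] : exists2 t, 0 <= t & (P [set w | (S t w < a)%R] <= (4^-1)%:E)%E.
  by apply: (prob_below_vanish hS).
pose B : set (T * R) := [set x | 0 < x.2] `&` [set x | x.2 < e] `&`
   [set x | x.2 <= S t x.1] `&` ((fun x => (x.2, x.1)) @^-1` [set x | creep S x.1 x.2]).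
have mB : measurable B.
  apply: measurableI; last first.
    rewrite -[X in measurable X]setTI.
    apply: (measurable_fun_pair measurable_snd measurable_fst) => //.
    exact: (measurable_creep_joint hS).
  apply: measurableI.
    by apply: measurableI; exact: measurable_lt_set.
  by apply: measurable_le_set => //; exact: (measurableT_comp (sub_meas hS t0)).
have f0 (x : T * R) : (0 <= (\1_B x)%:E :> \bar R)%E by rewrite lee_fin.
have mf : measurable_fun setT (fun x : T * R => (\1_B x)%:E : \bar R).
  exact/measurable_EFinP/measurable_indic.
have I0 : (\int[lebesgue_measure]_y P (ysection B y) = 0)%E.
  transitivity (\int[lebesgue_measure]_y \int[P]_w (\1_B (w, y))%:E)%E.
    apply: eq_integral => y _.
    rewrite -(ge0_integral_indicT P (measurable_ysection y mB)).
    by apply: eq_integral => w _; rewrite !indicE mem_ysection.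
  apply: eq_trans (esym (@fubini_tonelli _ _ _ _ _ P lebesgue_measure _ mf f0)) _.
  apply: integral0_eq => w _.
  transitivity (\int[lebesgue_measure]_y (\1_(xsection B w) y)%:E)%E.
    by apply: eq_integral => y _; rewrite !indicE mem_xsection.
  rewrite ge0_integral_indicT; last exact: measurable_xsection.
  apply: (creeps_null (subordinator_path hS w) t0) => //.
  - exact: (sub_jumps hS).
  - exact: measurable_xsection.
  - by move=> y /xsectionP[[[/= y0 _] yS] cy]; split => //; rewrite y0.
have : ((4^-1)%:E * lebesgue_measure `]0%R, e[%classic <= 0)%E.
  rewrite -[leRHS]I0 -integral_cst//.
  rewrite [leLHS]integral_mkcond; apply: ge0_le_integral => //.
  - by move=> y _; rewrite patchE; case: ifP; rewrite //= lee_fin.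
  - by apply/measurable_restrict => //; exact: measurable_cst.
  - exact: measurable_fun_ysection.
  - move=> y _; rewrite patchE; case: ifPn => [|_]; last exact: measure_ge0.
    move/set_mem; rewrite /= in_itv/= => /andP[y0 ye].
    have py : 2^-1 <= p y.
      by rewrite leNgt; apply/negP => py; apply: ny; exists y => //; rewrite y0.
    have my := measurable_creep hS y; have ms := measurable_S_lt hS a t0.
    have : (P (creep S y) <= P (ysection B y) + P [set w | (S t w < a)%R])%E.
      apply: le_trans (measureU2 P (measurable_ysection y mB) ms).
      apply: le_measure; rewrite ?inE//.
        by apply: measurableU => //; exact: measurable_ysection.
      move=> w cw; have [ys|sy] := leP y (S t w).
        by left; apply/ysectionP; split.
      by right; rewrite /= (lt_trans sy)// (lt_le_trans ye).
    rewrite (creep_probE hS) => H.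
    have : ((p y)%:E <= P (ysection B y) + (4^-1)%:E)%E.
      by apply: (le_trans H); rewrite leeD2l.
    rewrite -leeBlDr// -EFinB; apply: le_trans; rewrite /= lee_fin; lra.
rewrite lebesgue_measure_itv/= lte_fin e0 -EFinB -EFinM lee_fin; lra.
Qed.

Lemma tail_gt0 : Pi `]0, +oo[%classic = +oo%E -> exists2 a, 0 < a & 0 < tail Pi a.
Proof.
move=> Pioo; apply: contrapT => na.
suff : Pi `]0, +oo[%classic = 0%E by rewrite Pioo.
have -> : `]0, +oo[%classic = \bigcup_n `[n.+1%:R^-1, +oo[%classic :> set R.
  apply/seteqP; split=> x /=; rewrite in_itv/= andbT.
    move=> /ltr_add_invr[n]; rewrite add0r => nx; exists n => //=.
    by rewrite in_itv/= andbT ltW.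
  by move=> [n _]; rewrite /= in_itv/= andbT => /(lt_le_trans _); apply.
apply/eqP; rewrite eq_le measure_ge0 andbT.
apply: (@le_trans _ _ (\sum_(n <oo) Pi `[n.+1%:R^-1%R, +oo[%classic)%E).
  by apply: measure_sigma_subadditive => //; exact: bigcupT_measurable.
rewrite eseries0// => n _ _; rewrite (tailE hS)//; congr EFin; apply/eqP.
rewrite eq_le tail_ge0 andbT leNgt; apply/negP => T0; apply: na.
by exists n.+1%:R^-1.
Qed.

(** Kesten's theorem.  If [p x] and [p h] exceed [15/16] and [p (u + h) >= 3/4], where
    [u < x], then [creep_prob_step] at [u + h] gives [p u >= 11/16], and at [x] it excludes
    the values of [p u] between [11/16] and [3/4].  So [p >= 3/4] descends from [x] in steps
    of length [h]. *)
Theorem creep_prob0 r : Pi `]0, +oo[%classic = +oo%E -> 0 < r -> p r = 0.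
Proof.
move=> /tail_gt0[a a0 T0] r0; apply/eqP; rewrite eq_le creep_prob_ge0 andbT.
rewrite leNgt; apply/negP => pr.
have near1 := @creep_prob_near1 r a (15 / 16) r0 a0 T0.
have {}near1 e : 0 < e -> exists2 h, 0 < h < e & 15 / 16 < p h.
  by apply: near1 => //; lra.
have [x /andP[x0 xa] px] := near1 a a0.
have [y /andP[y0 yx] py] := creep_prob_small a0 T0 x0 (ltW xa).
suff : 3 / 4 <= p y by lra.
apply: creep_prob_usc => eta eta0.
have [|h /andP[h0 +] ph] := near1 (Num.min eta y); first by rewrite lt_min eta0.
rewrite lt_min => /andP[heta hy].
(* One step down from [h + u] to [u], where [x = u + v] with [v] a multiple of [h]. *)
have pu j : 0 < x - j%:R * h -> 3 / 4 <= p (x - j%:R * h).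
  elim: j => [_|j IH u0]; first by rewrite mul0r subr0; lra.
  set u := x - _ in u0 *; pose v := j.+1%:R * h.
  have v0 : 0 < v by rewrite mulr_gt0.
  have uhE : x - j%:R * h = h + u by rewrite /u -natr1; lra.
  have uvE : x = u + v by rewrite /u /v; lra.
  have := IH; rewrite uhE => /(_ (addr_gt0 h0 u0)) IH'.
  have s1 : p (h + u) <= p h * p u + (1 - p h).
    by apply: creep_prob_step T0 => //; rewrite -uhE; have := mulr_ge0 (ler0n R j) (ltW h0); lra.
  have s2 : p x <= p u * p v + (1 - p u).
    by rewrite uvE; apply: creep_prob_step T0 => //; rewrite -uvE ltW.
  have s3 : p x <= p v * p u + (1 - p v).
    by rewrite uvE addrC; apply: creep_prob_step T0 => //; rewrite addrC -uvE ltW.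
  have := creep_prob_ge0 P S u; have := creep_prob_ge0 P S v.
  have := creep_prob_le1 hS u; have := creep_prob_le1 hS v.
  have := creep_prob_le1 hS h.
  move: (p u) (p v) (p h) (p x) (p (h + u)) s1 s2 s3 IH' ph px.
  move=> pu' pv ph' px' phu s1 s2 s3 IH' ph px ph1 pv1 pu1 pv0 pu0.
  (* [s1] bounds [p u] from below, hence [s2] makes [p v] close to [1], and then
     [s3] improves the bound on [p u]. *)
  have l1 : 11 / 16 <= pu' by nra.
  have l2 : 10 / 11 <= pv by nra.
  by nra.
(* Some member of the progression lies within [h] below [y]. *)
have xyh : 0 <= (x - y) / h by rewrite divr_ge0// ltW// subr_gt0.
have /andP[k1 k2] := truncn_itv xyh.
set k := Num.truncn _ in k1 k2.
exists (x - k.+1%:R * h).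
  move: k1 k2; rewrite ler_pdivlMr// ltr_pdivrMr// -natr1; lra.
by apply: pu; move: k1; rewrite ler_pdivlMr// -natr1; lra.
Qed.

End no_creeping.

(** * The compensator of a monotone function of the process *)

Section level_passage.
Context {R : realType} {d : measure_display} {T : measurableType d}.
Variables (P : probability T R) (S : R -> T -> R).
Variable Pi : {sigma_finite_measure set R -> \bar R}.
Hypothesis hS : driftless_subordinator P S Pi.
Local Notation F := (natural_filtration S).

Hypothesis Pioo : Pi `]0, +oo[%classic = +oo%E.

(** [creep_formula], in which creeping is negligible by [creep_prob0]. *)
Lemma level_formula A s t r : 0 <= s -> s <= t -> F s A ->
  P (A `&` ([set w | S s w < r] `&` [set w | r <= S t w])) =
  (\int[P \x lebesgue_measure]_(x in A `*` `]s, t]%classic)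
     leap_rate Pi r r (S0 S x.2 x.1))%E.
Proof.
move=> s0 st FA; have mA := past_sub hS FA; have t0 := le_trans s0 st.
have [r0|r0] := leP r 0.
  rewrite [X in P X](_ : _ = set0); last first.
    apply/seteqP; split=> // w [_ [/= Sr _]].
    by have := sub_ge0 hS w s0; rewrite leNgt (lt_le_trans Sr).
  rewrite measure0; apply/esym/integral0_eq => x _; rewrite /leap_rate ifF//.
  apply/negbTE; rewrite -leNgt (le_trans r0)//; apply: (sub_ge0 hS).
  by rewrite le_max lexx orbT.
rewrite -(creep_formula hS _ s0 st FA).
set U := _ `&` [set w | r <= S t w].
have mU : measurable U.
  by apply: measurableI; [exact: (measurable_S_lt hS)|exact: (measurable_S_ge hS)].
have mc := measurable_creep hS r.
have c0 : P (creep S r) = 0%E by rewrite (creep_probE hS) (creep_prob0 hS).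
rewrite setDE setIA -setDE; apply/esym.
have mAU := measurableI _ _ mA mU.
apply: eq_trans (measureD mAU mc _) _; first by rewrite -ge0_fin_numE// fin_num_measure.
rewrite [X in (_ - X)%E](_ : _ = 0%E) ?sube0//.
by apply: subset_measure0 c0 => //; exact: measurableI.
Qed.

Section layer_cake.
Variable g : R -> R.
Hypothesis g_nd : {homo g : x y / x <= y}.
Hypothesis g_rc : forall z, 0 <= z -> g y @[y --> z^'+] --> g z.

(** The points where [g >= c] form an upper set by monotonicity, which contains its infimum
    by right-continuity if it is not empty. *)
Lemma threshold c : (forall z, 0 <= z -> g z < c) \/
  exists r, forall z, 0 <= z -> (c <= g z) = (r <= z).
Proof.
pose L := [set z | 0 <= z /\ c <= g z].
have [L0|] := pselect (L !=set0); last first.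
  move=> nL; left=> z z0; rewrite ltNge; apply/negP => cz; apply: nL.
  by exists z.
have hL : has_inf L by split=> //; exists 0 => z [].
have i0 : 0 <= inf L by apply: lb_le_inf => // z [].
right; exists (inf L) => z z0; apply/idP/idP => [cz|].
  by apply: ge_inf; [exists 0 => y []|split].
have above y : inf L < y -> c <= g y.
  move=> Ly; have [|l [l0 cl] ly] := @inf_adherent _ L (y - inf L) _ hL.
    by rewrite subr_gt0.
  by rewrite subrKC in ly; rewrite (le_trans cl)// g_nd// ltW.
rewrite le_eqVlt => /predU1P[<-|/above//].
apply: (cvgr_to_ge (g_rc i0)); near=> y; apply: above.
by near: y; exact: nbhs_right_gt.
Unshelve. all: by end_near. Qed.

Lemma measurable_g : measurable_fun setT g.
Proof. exact: nondecreasing_measurable. Qed.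

(** From [z] the process makes [g] pass the level [c] by a jump of one of these sizes. *)
Definition level_rate (z c : R) : \bar R :=
  Pi [set y | 0 < y /\ g z < c <= g (z + y)].

Lemma level_step A s t x c : 0 <= s -> s <= t -> 0 <= x -> F s A ->
  P (A `&` [set w | g (x + S s w) < c <= g (x + S t w)]) =
  (\int[P \x lebesgue_measure]_(z in A `*` `]s, t]%classic)
     level_rate (x + S0 S z.2 z.1) c)%E.
Proof.
move=> s0 st x0 FA; have t0 := le_trans s0 st.
have S00 v w : 0 <= S0 S v w by apply: (sub_ge0 hS); rewrite le_max lexx orbT.
have [gc|[r rP]] := threshold c.
  rewrite [X in P X](_ : _ = set0); last first.
    apply/seteqP; split=> // w [_ /= /andP[_]]; rewrite leNgt gc//.
    by rewrite addr_ge0// (sub_ge0 hS).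
  rewrite measure0; apply/esym/integral0_eq => z _; rewrite /level_rate.
  rewrite [X in Pi X](_ : _ = set0) ?measure0//; apply/seteqP; split=> // y [y0] /andP[_].
  by rewrite leNgt gc// !addr_ge0// ltW.
have rP' z : 0 <= z -> (g z < c) = (z < r) by move=> z0; rewrite !ltNge rP.
rewrite [X in P X](_ : _ = A `&` ([set w | S s w < r - x] `&` [set w | r - x <= S t w])).
  rewrite level_formula//; apply: eq_integral => z _.
  set v := S0 S z.2 z.1; have v0 : 0 <= v by exact: S00.
  have xv0 : 0 <= x + v by exact: addr_ge0.
  rewrite /level_rate /leap_rate (rP' _ xv0); case: ltP => vr.
    congr (Pi _); apply/seteqP; split=> y /=; rewrite in_itv/= andbT.
      move=> ry; have y0 : 0 < y by lra.
      by split=> //; rewrite rP; [apply/andP; split; lra|lra].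
    by move=> [y0 /andP[_]]; rewrite rP; lra.
  rewrite [X in Pi X](_ : _ = set0) ?measure0//; apply/seteqP; split=> // y [y0].
  by move=> /andP[+ _]; lra.
apply/seteqP; split=> w /= [Aw]; rewrite rP' ?rP ?addr_ge0// ?(sub_ge0 hS)//.
  by move=> /andP[? ?]; split=> //; split; lra.
by move=> [? ?]; split=> //; apply/andP; split; lra.
Qed.

End layer_cake.

End level_passage.

Section increments.
Context {R : realType} {d : measure_display} {T : measurableType d}.
Variables (P : probability T R) (S : R -> T -> R).
Variable Pi : {sigma_finite_measure set R -> \bar R}.
Hypothesis hS : driftless_subordinator P S Pi.
Local Notation F := (natural_filtration S).

Hypothesis Pioo : Pi `]0, +oo[%classic = +oo%E.
Variable g : R -> R.
Hypothesis g_nd : {homo g : x y / x <= y}.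
Hypothesis g_rc : forall z, 0 <= z -> g y @[y --> z^'+] --> g z.

Let mg : measurable_fun setT g := measurable_g g_nd.

Definition jump_rate (z : R) : \bar R :=
  (\int[Pi]_(y in `]0%R, +oo[) (g (z + y) - g z)%:E)%E.

Lemma measurable_level_rate :
  measurable_fun setT (fun x : R * R => level_rate Pi g x.1 x.2).
Proof.
pose E : set ((R * R) * R) := [set x | 0 < x.2] `&` ([set x | g x.1.1 < x.1.2] `&`
  [set x | x.1.2 <= g (x.1.1 + x.2)]).
have m11 : measurable_fun setT (fun x : (R * R) * R => x.1.1).
  exact: (measurableT_comp measurable_fst).
have m12 : measurable_fun setT (fun x : (R * R) * R => x.1.2).
  exact: (measurableT_comp measurable_snd).
have mE : measurable E.
  apply: measurableI; first exact: measurable_lt_set.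
  apply: measurableI; first by apply: measurable_lt_set => //; exact: (measurableT_comp mg).
  apply: measurable_le_set => //; apply: (measurableT_comp mg).
  exact: measurable_funD.
rewrite (_ : (fun x => _) = Pi \o xsection E); first exact: measurable_fun_xsection.
apply/funext => -[z c] /=; congr (Pi _); apply/seteqP; split=> y /=.
  by move=> [y0 /andP[? ?]]; apply/xsectionP.
by move=> /xsectionP[/= ? [? ?]]; split=> //; apply/andP.
Qed.

Lemma level_rate_ge0 z c : (0 <= level_rate Pi g z c)%E.
Proof. exact: measure_ge0. Qed.

(** The layer cake formula: [g (z + y) - g z] is the length of ]g z, g (z + y)]. *)
Lemma jump_rateE z : jump_rate z = (\int[lebesgue_measure]_c level_rate Pi g z c)%E.
Proof.
pose E : set (R * R) := [set x | g z < x.2] `&` [set x | x.2 <= g (z + x.1)].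
have mE : measurable E.
  apply: measurableI; first exact: measurable_lt_set.
  apply: measurable_le_set => //; apply: (measurableT_comp mg).
  exact: measurable_funD.
have := tonelli_section Pi (measurable_itv `]0%R, +oo[) mE.
move=> H; apply: eq_trans (eq_trans _ H) _.
  apply: eq_integral => y; rewrite inE/= in_itv/= andbT => y0.
  rewrite -length_oc; last by rewrite g_nd// lerDl ltW.
  congr (lebesgue_measure _); apply/seteqP; split=> c /=.
    by move=> /andP[? ?]; apply/xsectionP.
  by move=> /xsectionP[/= ? ?]; apply/andP.
apply: eq_integral => c _; congr (Pi _); apply/seteqP; split=> y /=.
  by rewrite in_itv/= andbT => -[y0 /ysectionP[/= ? ?]]; split=> //; apply/andP.
by move=> [y0 /andP[? ?]]; split; [rewrite in_itv/= y0|apply/ysectionP].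
Qed.

Lemma jump_rate_ge0 z : (0 <= jump_rate z)%E.
Proof. by rewrite jump_rateE; apply: integral_ge0 => c _; exact: level_rate_ge0. Qed.

Lemma measurable_jump_rate : measurable_fun setT jump_rate.
Proof.
rewrite (_ : jump_rate = fubini_F lebesgue_measure (fun x : R * R => level_rate Pi g x.1 x.2)).
  apply: measurable_fun_fubini_tonelli_F; first exact: measurable_level_rate.
  by move=> x; exact: level_rate_ge0.
by apply/funext => z; rewrite jump_rateE.
Qed.

(** The layer cake formula for [g (x + S t) - g (x + S s)], then [level_step] for each [c],
    and [jump_rateE] to integrate over [c] again. *)
Theorem increment_formula A s t x : 0 <= s -> s <= t -> 0 <= x -> F s A ->
  (\int[P]_(w in A) (g (x + S t w)%R - g (x + S s w)%R)%:E =
   \int[P \x lebesgue_measure]_(z in A `*` `]s, t]%classic)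
     jump_rate (x + S0 S z.2 z.1)%R)%E.
Proof.
move=> s0 st x0 FA; have mA := past_sub hS FA; have t0 := le_trans s0 st.
pose E : set (T * R) := [set z | g (x + S s z.1) < z.2] `&` [set z | z.2 <= g (x + S t z.1)].
have mS u : 0 <= u -> measurable_fun setT (fun z : T * R => g (x + S u z.1)).
  move=> u0; apply: (measurableT_comp mg); apply: measurable_funD => //.
  exact: (measurableT_comp (sub_meas hS u0)).
have mE : measurable E.
  by apply: measurableI; [apply: measurable_lt_set|apply: measurable_le_set] => //; exact: mS.
have H := tonelli_section P mA mE.
apply: eq_trans (eq_trans _ H) _.
  apply: eq_integral => w _; rewrite -length_oc; last first.
    by rewrite g_nd// lerD2l (path_homo (subordinator_path hS w)).
  congr (lebesgue_measure _); apply/seteqP; split=> c /=.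
    by move=> /andP[? ?]; apply/xsectionP.
  by move=> /xsectionP[/= ? ?]; apply/andP.
have mD : measurable (A `*` `]s, t]%classic) by exact: measurableX.
pose K (y : (T * R) * R) : \bar R := level_rate Pi g (x + S0 S y.1.2 y.1.1) y.2.
have mK : measurable_fun setT K.
  apply: (measurableT_comp measurable_level_rate
     (g := fun y : (T * R) * R => (x + S0 S y.1.2 y.1.1, y.2))).
  apply: measurable_fun_pair => //; apply: measurable_funD => //.
  exact: (measurableT_comp (measurable_S0 hS)).
have K0 y : (0 <= K y)%E by exact: level_rate_ge0.
pose K2 (y : T * R) : \bar R :=
  (\int[lebesgue_measure]_(v in `]s, t]%classic) K ((y.1, v), y.2))%E.
have m3 : measurable_fun setT (fun y : (T * R) * R => ((y.1.1, y.2), y.1.2)).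
  apply: measurable_fun_pair; last exact: (measurableT_comp measurable_snd).
  by apply: measurable_fun_pair => //; exact: (measurableT_comp measurable_fst).
have mK2 : measurable_fun setT K2.
  apply: (measurable_integral_snd lebesgue_measure (f := fun y : (T * R) * R => K ((y.1.1, y.2), y.1.2))) => //.
  exact: (measurableT_comp mK m3).
have K20 y : (0 <= K2 y)%E by apply: integral_ge0 => v _; exact: K0.
have mJ : measurable_fun setT (fun z : T * R => jump_rate (x + S0 S z.2 z.1)).
  apply: (measurableT_comp measurable_jump_rate); apply: measurable_funD => //.
  exact: (measurable_S0 hS).
have J0 (z : T * R) : (0 <= jump_rate (x + S0 S z.2 z.1))%E by exact: jump_rate_ge0.
have mI : measurable (`]s, t]%classic : set R) by exact: measurable_itv.
rewrite (ge0_integral_setX1 P lebesgue_measure mA mI mJ J0).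
transitivity (\int[P]_(w in A) \int[lebesgue_measure]_(c in setT) K2 (w, c))%E; last first.
  apply: eq_integral => w _; rewrite /=.
  have mKw : measurable_fun setT (fun y : R * R => K ((w, y.1), y.2)).
    apply: (measurableT_comp mK (g := fun y : R * R => ((w, y.1), y.2))).
    by apply: measurable_fun_pair => //; exact: measurable_fun_pair.
  have Kw0 (y : R * R) : (0 <= K ((w, y.1), y.2))%E by exact: K0.
  rewrite -(ge0_integral_setX2 lebesgue_measure lebesgue_measure mI measurableT mKw Kw0).
  rewrite (ge0_integral_setX1 lebesgue_measure lebesgue_measure mI measurableT mKw Kw0).
  by apply: eq_integral => v _; rewrite jump_rateE.
rewrite -(ge0_integral_setX1 P lebesgue_measure mA measurableT mK2 K20).
rewrite (ge0_integral_setX2 P lebesgue_measure mA measurableT mK2 K20).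
apply: eq_integral => c _.
have mKc : measurable_fun setT (fun z : T * R => K (z, c)).
  by apply: (measurableT_comp mK); exact: measurable_fun_pair.
have Kc0 (z : T * R) : (0 <= K (z, c))%E by exact: K0.
rewrite -(ge0_integral_setX1 P lebesgue_measure mA mI mKc Kc0).
rewrite -(level_step hS Pioo g_nd g_rc c s0 st x0 FA).
congr (P (_ `&` _)); apply/seteqP; split=> w /=.
  by move=> /ysectionP[/= ? ?]; apply/andP.
by move=> /andP[? ?]; apply/ysectionP.
Qed.

End increments.

(** * The compensated process is a martingale *)

Section compensated_process.
Context {R : realType} {d : measure_display} {T : measurableType d}.
Variables (P : probability T R) (S : R -> T -> R).
Variable Pi : {sigma_finite_measure set R -> \bar R}.
Hypothesis hS : driftless_subordinator P S Pi.
Local Notation F := (natural_filtration S).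

Hypothesis Pioo : Pi `]0, +oo[%classic = +oo%E.
Variable g : R -> R.
Hypothesis g_nd : {homo g : x y / x <= y}.
Hypothesis g_rc : forall z, 0 <= z -> g y @[y --> z^'+] --> g z.
Variable M : R.
Hypothesis g_bnd : forall z, `|g z| <= M.
Variable x : R.
Hypothesis x0 : 0 <= x.

Let mg : measurable_fun setT g := measurable_g g_nd.

Definition drift (u t : R) (w : T) : \bar R :=
  (\int[lebesgue_measure]_(v in `]u, t]) jump_rate Pi g (x + S0 S v w)%R)%E.

Lemma drift_ge0 u t w : (0 <= drift u t w)%E.
Proof. by apply: integral_ge0 => v _; exact: jump_rate_ge0. Qed.

Lemma measurable_rate_path :
  measurable_fun setT (fun z : T * R => jump_rate Pi g (x + S0 S z.2 z.1)).
Proof.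
apply: (measurableT_comp (measurable_jump_rate Pi g_nd)); apply: measurable_funD => //.
exact: (measurable_S0 hS).
Qed.

Lemma measurable_rate_time w :
  measurable_fun setT (fun v => jump_rate Pi g (x + S0 S v w)).
Proof. exact: (measurable_fun_pair2 w measurable_rate_path). Qed.

Lemma measurable_drift u t : measurable_fun setT (drift u t).
Proof.
apply: (measurable_integral_snd lebesgue_measure
  (f := fun z : T * R => jump_rate Pi g (x + S0 S z.2 z.1))) => //.
  exact: measurable_rate_path.
by move=> z; exact: jump_rate_ge0.
Qed.

(** On ]u, t] the process may be replaced by [Sclamp], which only depends on the past of
    [t]. *)
Lemma past_drift u t : 0 <= u -> 0 <= t ->
  measurable_fun setT (drift u t : past S t -> \bar R).
Proof.
move=> u0 t0.
have mf : measurable_fun setT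
    (fun z : past S t * R => jump_rate Pi g (x + Sclamp S t z.2 z.1)).
  apply: (measurableT_comp (measurable_jump_rate Pi g_nd)); apply: measurable_funD => //.
  exact: (measurable_Sclamp hS).
have f0 (z : past S t * R) : (0 <= jump_rate Pi g (x + Sclamp S t z.2 z.1))%E.
  exact: jump_rate_ge0.
have := measurable_integral_snd lebesgue_measure (measurable_itv `]u, t]) mf f0.
congr measurable_fun; apply/funext => w; apply: eq_integral => v.
rewrite inE/= in_itv/= => /andP[uv vt]; have v0 : 0 <= v by rewrite (le_trans u0)// ltW.
by rewrite S0E// SclampE// v0.
Qed.

Lemma drift_cat s u t w : s <= u -> u <= t ->
  drift s t w = (drift s u w + drift u t w)%E.
Proof.
move=> su ut; rewrite /drift -ge0_integral_setU//=.
- congr (integral _ _ _); apply/seteqP; split=> v /=; rewrite !in_itv/=.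
    by move=> /andP[sv vt]; case: (leP v u) => vu; [left; rewrite sv|right].
  by move=> [] /andP[? ?]; apply/andP; split; lra.
- exact: measurable_funTS (measurable_rate_time w).
- by move=> v _; exact: jump_rate_ge0.
- rewrite disj_set2E; apply/eqP/seteqP; split=> // v [] /=; rewrite !in_itv/=.
  by move=> /andP[? ?] /andP[? ?]; lra.
Qed.

Lemma integral_drift A u t : 0 <= u -> u <= t -> F u A ->
  (\int[P]_(w in A) drift u t w =
   \int[P]_(w in A) (g (x + S t w)%R - g (x + S u w)%R)%:E)%E.
Proof.
move=> u0 ut FA; rewrite (increment_formula hS Pioo g_nd g_rc u0 ut x0 FA).
have J0 (z : T * R) : (0 <= jump_rate Pi g (x + S0 S z.2 z.1)%R)%E.
  exact: jump_rate_ge0.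
have mI : measurable (`]u, t]%classic : set R) by exact: measurable_itv.
by rewrite (ge0_integral_setX1 P lebesgue_measure (past_sub hS FA) mI measurable_rate_path J0).
Qed.

Lemma measurable_gS t : 0 <= t -> measurable_fun setT (fun w => g (x + S t w)).
Proof.
move=> t0; apply: (measurableT_comp mg); apply: measurable_funD => //.
exact: (sub_meas hS).
Qed.

Lemma g_bounds u t w : 0 <= u -> u <= t ->
  0 <= g (x + S t w) - g (x + S u w) <= M + M.
Proof.
move=> u0 ut; have : g (x + S u w) <= g (x + S t w).
  by rewrite g_nd// lerD2l (path_homo (subordinator_path hS w)).
have := g_bnd (x + S t w); have := g_bnd (x + S u w); rewrite !ler_norml.
by move=> /andP[? ?] /andP[? ?] ?; apply/andP; split; lra.
Qed.

Lemma integrable_g A t : 0 <= t -> measurable A ->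
  P.-integrable A (fun w => (g (x + S t w))%:E).
Proof.
move=> t0 mA; apply: measurable_bounded_integrable => //.
- by rewrite -ge0_fin_numE// fin_num_measure.
- by apply: measurable_funTS; exact: measurable_gS.
- by exists M; split=> [|K MK w _]; [exact: num_real|rewrite /= (le_trans (g_bnd _))// ltW].
Qed.

Lemma integrable_drift A u t : 0 <= u -> u <= t -> measurable A ->
  P.-integrable A (drift u t).
Proof.
move=> u0 ut mA; apply: (@integrableS _ _ _ _ setT) => //.
apply/integrableP; split; first exact: measurable_drift.
under eq_integral do rewrite (gee0_abs (drift_ge0 _ _ _)).
rewrite (integral_drift u0 ut (@past_setT _ _ _ S u)).
apply: (@le_lt_trans _ _ (\int[P]_(w in setT) (cst (M + M)%:E w))%E).
  apply: ge0_le_integral => //.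
  - by move=> w _; rewrite lee_fin; have /andP[] := g_bounds w u0 ut.
  - apply/measurable_EFinP; apply: measurable_funB; apply: measurable_gS => //.
    exact: le_trans ut.
  - by move=> w _; rewrite lee_fin; have /andP[] := g_bounds w u0 ut.
rewrite integral_cst// [X in (_ * X)%E](_ : _ = 1%E) ?mule1 ?ltry//.
exact: probability_setT.
Qed.

(** The drift may be infinite on a null set of paths, where [fine] makes it [0]; the
    identities between values of this process hold almost everywhere only. *)
Definition compensated (t : R) (w : T) : R := g (x + S t w) - fine (drift 0 t w).

(** The increment of [compensated] over ]u, t], for almost every path. *)
Definition excess (u t : R) (w : T) : R :=
  g (x + S t w) - g (x + S u w) - fine (drift u t w).

Lemma measurable_fine_drift u t : measurable_fun setT (fine \o drift u t).
Proof. exact: (measurableT_comp (fine_measurable _) (measurable_drift u t)). Qed.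

Lemma drift_fin u t : 0 <= u -> u <= t ->
  {ae P, forall w, drift u t w \is a fin_num}.
Proof.
move=> u0 ut; have := integrable_ae measurableT (integrable_drift u0 ut measurableT).
by apply: filterS => w; exact.
Qed.

Lemma integrable_fine_drift A u t : 0 <= u -> u <= t -> measurable A ->
  P.-integrable A (EFin \o (fine \o drift u t)).
Proof.
move=> u0 ut mA; apply: le_integrable (integrable_drift u0 ut mA) => //.
  by apply/measurable_EFinP; apply: measurable_funTS; exact: measurable_fine_drift.
move=> w _ /=; have := drift_ge0 u t w; case: (drift u t w) => //= _.
by rewrite normr0 leey.
Qed.

Lemma integral_fine_drift A u t : 0 <= u -> u <= t -> measurable A ->
  (\int[P]_(w in A) (fine (drift u t w))%:E = \int[P]_(w in A) drift u t w)%E.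
Proof.
move=> u0 ut mA; apply: ae_eq_integral => //.
- by apply/measurable_EFinP; apply: measurable_funTS; exact: measurable_fine_drift.
- by apply: measurable_funTS; exact: measurable_drift.
- by have := drift_fin u0 ut; apply: filterS => w fw _; rewrite fineK.
Qed.

Lemma integrable_compensated A t : 0 <= t -> measurable A ->
  P.-integrable A (EFin \o compensated t).
Proof.
move=> t0 mA; rewrite (_ : EFin \o _ =
  (fun w => (g (x + S t w))%:E) \- (EFin \o (fine \o drift 0 t)))%E//.
by apply: integrableB => //; [exact: integrable_g|exact: integrable_fine_drift].
Qed.

Lemma integrable_increment A u t : 0 <= u -> u <= t -> measurable A ->
  P.-integrable A (fun w => (g (x + S t w) - g (x + S u w))%:E).
Proof.
move=> u0 ut mA; rewrite (_ : (fun w => _) =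
  (fun w => (g (x + S t w))%:E) \- (fun w => (g (x + S u w))%:E))%E//.
by apply: integrableB => //; apply: integrable_g => //; exact: le_trans ut.
Qed.

Lemma integrable_excess A u t : 0 <= u -> u <= t -> measurable A ->
  P.-integrable A (EFin \o excess u t).
Proof.
move=> u0 ut mA; rewrite (_ : EFin \o _ =
  (fun w => (g (x + S t w) - g (x + S u w))%:E) \- (EFin \o (fine \o drift u t)))%E//.
by apply: integrableB => //; [exact: integrable_increment|exact: integrable_fine_drift].
Qed.

Lemma integral_excess0 A u t : 0 <= u -> u <= t -> F u A ->
  (\int[P]_(w in A) (excess u t w)%:E = 0)%E.
Proof.
move=> u0 ut FA; have mA := past_sub hS FA.
transitivity (\int[P]_(w in A) ((g (x + S t w) - g (x + S u w))%R%:E -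
   (fine (drift u t w))%:E))%E; first by [].
rewrite integralB_EFin//; last 2 first.
- exact: integrable_increment.
- exact: integrable_fine_drift.
rewrite integral_fine_drift// (integral_drift u0 ut FA) subee//.
exact: integrable_fin_num (integrable_increment u0 ut mA).
Qed.

(** Both the increment of [g (x + S)] and the drift are nonnegative, with the same mean. *)
Lemma integral_excess_le A u t : 0 <= u -> u <= t -> measurable A ->
  (`| \int[P]_(w in A) (excess u t w)%:E | <=
   2%:E * \int[P]_w (g (x + S t w) - g (x + S u w))%R%:E)%E.
Proof.
move=> u0 ut mA.
have mE : measurable_fun A (EFin \o excess u t).
  by have /integrableP[] := integrable_excess u0 ut mA.
apply: le_trans (le_abse_integral _ mA mE) _.
have mD := measurable_drift u t; have t0 := le_trans u0 ut.
have mI : measurable_fun setT (fun w => (g (x + S t w) - g (x + S u w))%:E).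
  by apply/measurable_EFinP; apply: measurable_funB; exact: measurable_gS.
apply: (@le_trans _ _ (\int[P]_(w in A)
    ((g (x + S t w) - g (x + S u w))%R%:E + drift u t w))%E).
  apply: ge0_le_integral => //.
  - exact: measurableT_comp.
  - by apply: measurable_funTS; exact: emeasurable_funD.
  - move=> w _; have /andP[g0 _] := g_bounds w u0 ut; rewrite /excess /=.
    have := drift_ge0 u t w; case: (drift u t w) => [r|_|]//=.
      rewrite lee_fin => r0; rewrite -EFinD lee_fin ler_norml; apply/andP; split; lra.
    by rewrite addeC leey.
apply: (@le_trans _ _ (\int[P]_(w in setT)
    ((g (x + S t w) - g (x + S u w))%R%:E + drift u t w))%E).
  apply: ge0_subset_integral => //; first exact: emeasurable_funD.
  move=> w _; rewrite adde_ge0// ?drift_ge0// lee_fin.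
  by have /andP[] := g_bounds w u0 ut.
rewrite ge0_integralD//; last 2 first.
- by move=> w _; rewrite lee_fin; have /andP[] := g_bounds w u0 ut.
- by move=> w _; exact: drift_ge0.
rewrite (integral_drift u0 ut (@past_setT _ _ _ S u)).
by rewrite (_ : 2%:E = 1%:E + 1%:E)%E ?ge0_muleDl ?mul1e// -EFinD.
Qed.

(** Right-continuity of [g] and of the paths, and boundedness of [g]. *)
Lemma increment_vanish s : 0 <= s ->
  (\int[P]_w (g (x + S (s + n.+1%:R^-1)%R w) - g (x + S s w))%R%:E)%E @[n --> \oo] --> 0%E.
Proof.
move=> s0; rewrite (_ : 0%E = \int[P]_(w in setT) (cst 0%E w))%E; last first.
  by rewrite integral_cst// mul0e.
have sn n : s <= s + n.+1%:R^-1 by rewrite lerDl.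
apply: (@bounded_convergence _ _ _ P setT (M + M)) => //.
- by rewrite -ge0_fin_numE// fin_num_measure.
- move=> n; apply/measurable_EFinP; apply: measurable_funB; apply: measurable_gS => //.
  by rewrite addr_ge0.
- by move=> n w _; rewrite lee_fin; have /andP[] := g_bounds w s0 (sn n).
- by move=> n w _; rewrite lee_fin; have /andP[] := g_bounds w s0 (sn n).
move=> w _; apply: cvg_EFin; first exact: nearW.
have xS0 : 0 <= x + S s w by rewrite addr_ge0// (sub_ge0 hS).
apply/cvgrPdist_lt => e e0.
have gS : \forall y \near (x + S s w)^'+, g y < g (x + S s w) + e.
  by apply: (cvgr_lt _ (g_rc xS0)); rewrite ltrDl.
have [y [xy gy]] : exists y, x + S s w < y /\ g y < g (x + S s w) + e.
  near (x + S s w)^'+ => y; exists y; split; last by near: y.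
  by near: y; exact: nbhs_right_gt.
have [|h h0 Sh] := @path_stays_below _ _ (subordinator_path hS w) s (y - x) s0; first lra.
near=> n; rewrite sub0r normrN ger0_norm; last first.
  by have /andP[] := g_bounds w s0 (sn n).
rewrite ltrBlDl; apply: le_lt_trans gy; apply: g_nd; rewrite -lerBrDl ltW//.
apply: le_lt_trans Sh; apply: (path_homo (subordinator_path hS w)).
  by rewrite addr_ge0.
by rewrite lerD2l ltW//; near: n; exact: near_infty_natSinv_lt (PosNum h0).
Unshelve. all: by end_near. Qed.

Lemma excess_cat s u t : 0 <= s -> s <= u -> u <= t ->
  {ae P, forall w, compensated t w - compensated s w = excess s u w + excess u t w}.
Proof.
move=> s0 su ut; have u0 := le_trans s0 su.
have f1 := drift_fin (lexx 0) s0; have f2 := drift_fin s0 su.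
have f3 := drift_fin u0 ut.
apply: filterS (filterI f1 (filterI f2 f3)) => w [fs [fsu fut]].
rewrite /compensated /excess (drift_cat w s0 (le_trans su ut)) (drift_cat w su ut).
have e2 : fine (drift s u w + drift u t w)%E = fine (drift s u w) + fine (drift u t w).
  exact: fineD.
have e1 : fine (drift 0 s w + (drift s u w + drift u t w))%E =
    fine (drift 0 s w) + fine (drift s u w + drift u t w)%E.
  by apply: fineD => //; rewrite fin_numD fsu.
rewrite e1 e2.
lra.
Qed.

End compensated_process.

Section augmented_martingale.
Context {R : realType} {d : measure_display} {T : measurableType d}.
Variables (P : probability T R) (S : R -> T -> R).
Variable Pi : {sigma_finite_measure set R -> \bar R}.
Hypothesis hS : driftless_subordinator P S Pi.
Local Notation F := (natural_filtration S).

(** The sets that agree with an event of the past of [u] up to a negligible set form a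
    sigma-algebra.  Since the augmented filtration at [s] is an intersection over later
    times, [u] must be strictly later than [s]. *)
Lemma augmented_approx s A : augmented_filtration P S s A ->
  forall u, s < u -> exists2 A', F u A' & P.-negligible ((A `\` A') `|` (A' `\` A)).
Proof.
move=> HA u su; have {HA} := HA u; rewrite /= in_itv/= su => /(_ isT).
suff H : <<s F u `|` [set A | P.-negligible A] >> `<=`
    [set B | exists2 B', F u B' & P.-negligible ((B `\` B') `|` (B' `\` B))] by exact: H.
apply: smallest_sub; last first.
  move=> B [FB|nB].
    by exists B => //; rewrite setDv setU0; exact: negligible_set0.
  exists set0; first by rewrite measurable_past.
  by rewrite setD0 set0D setU0.
split.
- exists set0; first by rewrite measurable_past.
  by rewrite setDv setU0; exact: negligible_set0.
- move=> B [B' FB' nB]; exists (setT `\` B').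
    by move: FB'; rewrite !measurable_past => FB'; exact: measurableD.
  apply: negligibleS nB => w [[[_ nBw] nB'w]|[[_ nB'w] nBw]]; [right|left]; split=> //.
    by apply: contrapT => nb; apply: nB'w.
  by apply: contrapT => nb; apply: nBw.
move=> B HB.
have {}HB n : exists B', F u B' /\ P.-negligible ((B n `\` B') `|` (B' `\` B n)).
  by have [B' ? ?] := HB n; exists B'.
have [B' HB'] := choice HB.
exists (\bigcup_n B' n).
  rewrite measurable_past; apply: bigcupT_measurable => n.
  by have [] := HB' n.
apply: negligibleS (negligible_bigcup (fun n => (HB' n).2)).
move=> w [[[n _ Bw] nB]|[[n _ Bw] nB]]; exists n => //; [left|right]; split=> //.
  by move=> Bn; apply: nB; exists n.
by move=> Bn; apply: nB; exists n.
Qed.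

Lemma ae_eq_set_integral A A' (f : T -> \bar R) : measurable A -> measurable A' ->
  measurable_fun setT f -> P.-negligible ((A `\` A') `|` (A' `\` A)) ->
  (\int[P]_(w in A) f w = \int[P]_(w in A') f w)%E.
Proof.
move=> mA mA' mf nAA'; rewrite integral_mkcond [RHS]integral_mkcond.
apply: ae_eq_integral => //.
- by apply/measurable_restrict => //; exact: measurable_funTS.
- by apply/measurable_restrict => //; exact: measurable_funTS.
apply: negligibleS nAA' => w nE; apply: contrapT => nw; apply: nE => _.
rewrite !patchE; case: ifPn => [/set_mem|/negP] Aw; case: ifPn => [/set_mem|/negP] Aw' //.
  by exfalso; apply: nw; left; split => // A'w; apply: Aw'; rewrite inE.
by exfalso; apply: nw; right; split => // Aw2; apply: Aw; rewrite inE.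
Qed.

Lemma past_augmented t A : F t A -> augmented_filtration P S t A.
Proof.
move=> FA u; rewrite /= in_itv/= andbT => tu; apply: sub_sigma_algebra; left.
exact: past_mono (ltW tu) _ FA.
Qed.

Section martingale.
Hypothesis Pioo : Pi `]0, +oo[%classic = +oo%E.
Variable g : R -> R.
Hypothesis g_nd : {homo g : x y / x <= y}.
Hypothesis g_rc : forall z, 0 <= z -> g y @[y --> z^'+] --> g z.
Variable M : R.
Hypothesis g_bnd : forall z, `|g z| <= M.
Variable x : R.
Hypothesis x0 : 0 <= x.

Local Notation X := (compensated S Pi g x).
Local Notation Y := (excess S Pi g x).

Lemma past_compensated t : 0 <= t -> measurable_fun setT (X t : past S t -> R).
Proof.
move=> t0; apply: measurable_funB.
  apply: (measurableT_comp (measurable_g g_nd)); apply: measurable_funD => //.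
  by apply: past_value; rewrite t0 lexx.
have mf : measurable_fun setT (@fine R) by exact: fine_measurable.
exact: (measurableT_comp mf (past_drift hS g_nd x (lexx 0) t0)).
Qed.

(** For [s < u], [A] agrees up to a negligible set with an event of the past of [u], over
    which the increment from [u] to [t] has mean zero; only the increment over ]s, u]
    remains. *)
Lemma integral_compensated_le A s t u : 0 <= s -> s < u -> u <= t ->
  measurable A -> augmented_filtration P S s A ->
  (`| \int[P]_(w in A) (X t w - X s w)%:E | <=
   2%:E * \int[P]_w (g (x + S u w) - g (x + S s w))%R%:E)%E.
Proof.
move=> s0 su ut mA HA; have u0 : 0 <= u by rewrite (le_trans s0)// ltW.
have iX r : 0 <= r -> P.-integrable setT (EFin \o X r).
  move=> r0; exact: (integrable_compensated hS Pioo g_nd g_rc g_bnd x0 r0 measurableT).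
have iY a b : 0 <= a -> a <= b -> P.-integrable setT (EFin \o Y a b).
  move=> a0 ab; exact: (integrable_excess hS Pioo g_nd g_rc g_bnd x0 a0 ab measurableT).
have t0 := le_trans u0 ut.
have mX r : 0 <= r -> measurable_fun setT (EFin \o X r).
  by move=> r0; have /integrableP[] := iX r r0.
have mY a b : 0 <= a -> a <= b -> measurable_fun setT (EFin \o Y a b).
  by move=> a0 ab; have /integrableP[] := iY a b a0 ab.
have [A' FA' nAA'] := augmented_approx HA su.
rewrite (_ : (\int[P]_(w in A) (X t w - X s w)%:E)%E =
  (\int[P]_(w in A) (Y s u w)%:E)%E).
  exact: (integral_excess_le hS Pioo g_nd g_rc g_bnd x0 s0 (ltW su) mA).
transitivity (\int[P]_(w in A) ((Y s u w)%:E + (Y u t w)%:E))%E.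
  apply: ae_eq_integral => //.
  - by apply: measurable_funTS; apply/measurable_EFinP; apply: measurable_funB;
      apply/measurable_EFinP; exact: mX.
  - by apply: measurable_funTS; apply: emeasurable_funD; apply: mY => //; exact: ltW.
  - have := excess_cat hS Pioo g_nd g_rc g_bnd x0 s0 (ltW su) ut.
    by apply: filterS => w E _ /=; rewrite E EFinD.
rewrite integralD_EFin//; last 2 first.
- by apply: integrableS (iY _ _ s0 (ltW su)).
- by apply: integrableS (iY _ _ u0 ut).
rewrite (ae_eq_set_integral mA (past_sub hS FA') (mY _ _ u0 ut) nAA').
by rewrite (integral_excess0 hS Pioo g_nd g_rc g_bnd x0 u0 ut FA') adde0.
Qed.

(** Let [u] decrease to [s] in [integral_compensated_le]; the bound vanishes by
    [increment_vanish]. *)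
Theorem compensated_martingale : martingale P (augmented_filtration P S) X.
Proof.
have iX r : 0 <= r -> P.-integrable setT (EFin \o X r).
  move=> r0; exact: (integrable_compensated hS Pioo g_nd g_rc g_bnd x0 r0 measurableT).
have aX t : 0 <= t -> measurable_wrt (augmented_filtration P S t) (X t).
  move=> t0 B mB; apply: past_augmented; rewrite measurable_past.
  by rewrite -[X in measurable X]setTI; exact: (past_compensated t0).
split; [exact: aX|exact: iX|move=> s t s0 st].
have t0 := le_trans s0 st; split; [exact: aX|exact: iX|].
move=> A mA HA.
have iXA r : 0 <= r -> P.-integrable A (EFin \o X r).
  by move=> r0; apply: integrableS (iX r r0).
have fXA r : 0 <= r -> (\int[P]_(w in A) (X r w)%:E)%E \is a fin_num.
  by move=> r0; exact: integrable_fin_num (iXA r r0).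
move: st; rewrite le_eqVlt => /predU1P[->//|st].
suff D0 : (\int[P]_(w in A) (X t w - X s w)%:E = 0)%E.
  have : (\int[P]_(w in A) (X t w)%:E - \int[P]_(w in A) (X s w)%:E = 0)%E.
    by rewrite -integralB_EFin ?iXA.
  have := fXA _ t0; have := fXA _ s0.
  case: (integral _ _ _) => // b _; case: (integral _ _ _) => // a _.
  by rewrite -EFinB => -[] /eqP; rewrite subr_eq0 => /eqP ->.
apply/eqP; rewrite -abse_eq0 eq_le abse_ge0 andbT.
have vanish := increment_vanish hS g_nd g_rc g_bnd x0 s0.
have : (2%:E * \int[P]_w (g (x + S (s + n.+1%:R^-1)%R w) - g (x + S s w))%R%:E)%E
    @[n --> \oo] --> (2%:E * 0)%E by exact: cvgeZl.
rewrite mule0 => lim0; apply: (cvge_to_ge lim0); near=> n.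
have sn : s < s + n.+1%:R^-1 by rewrite ltrDl.
apply: integral_compensated_le => //.
rewrite -lerBrDl ltW//; near: n; apply: (near_infty_natSinv_lt (PosNum _)).
by rewrite subr_gt0.
Unshelve. all: by end_near. Qed.

End martingale.

End augmented_martingale.

(** * The extended generator *)

Theorem corollary2 (R : realType) (d : measure_display) (T : measurableType d)
  (P : probability T R) (S : R -> T -> R)
  (Pi : {sigma_finite_measure set R -> \bar R}) (f : R -> R)
  (hS : driftless_subordinator P S Pi)
  (hPi : Pi `]0, +oo[%classic = +oo%E)
  (f_bounded : [bounded f x | x in `[0, +oo[])
  (f_nondecreasing : {in `[0, +oo[ &, {homo f : x y / x <= y}})
  (f_right_continuous : forall x : R, 0 <= x -> f y @[y --> x^'+] --> f x) :
  extended_domain P S f /\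
  extended_generator P S f
    (fun x => \int[Pi]_(y in `]0%R, +oo[) (f (x + y) - f x)%:E)%E.
Proof.
set b := fun x => _.
suff Gf : extended_generator P S f b by split => //; exists b.
pose g x := f (Num.max x 0).
have max0 (x : R) : 0 <= Num.max x 0 by rewrite le_max lexx orbT.
have gE x : 0 <= x -> g x = f x by move=> x0; rewrite /g max_l.
have g_nd : {homo g : x y / x <= y}.
  move=> x y xy; apply: f_nondecreasing; rewrite ?in_itv/= ?max0//.
  by rewrite ge_max !le_max xy lexx !orbT.
have g_rc z : 0 <= z -> g y @[y --> z^'+] --> g z.
  move=> z0; rewrite gE//; apply: cvg_trans (f_right_continuous z z0).
  apply: near_eq_cvg; near=> y; rewrite gE//.
  by rewrite (le_trans z0)//; near: y; exact: nbhs_right_ge.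
have [M g_bnd] : exists M, forall z, `|g z| <= M.
  have [M0 [_ fM]] := f_bounded; exists (M0 + 1) => z.
  by apply: fM; rewrite ?ltrDl// /= in_itv/= max0.
have mg : measurable_fun setT g := measurable_g g_nd.
have bE x : 0 <= x -> b x = jump_rate Pi g x.
  move=> x0; apply: eq_integral => y; rewrite inE/= in_itv/= andbT => y0.
  by rewrite !gE// addr_ge0// ltW.
have S0v v w : 0 <= v -> 0 <= S v w by move=> v0; exact: (sub_ge0 hS).
have driftE x t w : 0 <= x -> 0 <= t ->
    (\int[lebesgue_measure]_(s in `[0%R, t]) b (x + S s w)%R)%E = drift S Pi g x 0 t w.
  move=> x0 t0; transitivity (\int[lebesgue_measure]_(s in `[0%R, t])
      jump_rate Pi g (x + S0 S s w)%R)%E.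
    apply: eq_integral => s; rewrite inE/= in_itv/= => /andP[s0 st].
    by rewrite bE ?S0E// addr_ge0// S0v.
  rewrite -integral_itv_obnd_cbnd//; apply: measurable_funTS.
  exact: (measurable_rate_time hS g_nd x w).
split.
- apply: (eq_measurable_fun g); last exact: measurable_funTS.
  by move=> x; rewrite inE/= in_itv/= andbT => x0; rewrite gE.
- apply: (eq_measurable_fun (jump_rate Pi g)).
    by move=> x; rewrite inE/= in_itv/= andbT => x0; rewrite bE.
  by apply: measurable_funTS; exact: measurable_jump_rate.
- move=> x t x0 t0.
  have := drift_fin hS hPi g_nd g_rc g_bnd x0 (lexx 0) t0.
  apply: filterS => w; rewrite -driftE// => fin.
  rewrite (_ : (\int[_]_(s in _) `|b _|)%E =
    (\int[lebesgue_measure]_(s in `[0%R, t]) b (x + S s w)%R)%E).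
    by rewrite -ge0_fin_numE// driftE//; exact: drift_ge0.
  apply: eq_integral => s; rewrite inE/= in_itv/= => /andP[s0 st].
  by rewrite bE ?addr_ge0// ?S0v// gee0_abs// jump_rate_ge0.
- move=> x x0.
  have [aX iX cX] := compensated_martingale hS hPi g_nd g_rc g_bnd x0.
  have XE t : 0 <= t -> (fun w => f (x + S t w) -
      fine (\int[lebesgue_measure]_(s in `[0%R, t]) b (x + S s w)%R)%E) =
      compensated S Pi g x t.
    move=> t0; apply/funext => w; rewrite driftE// /compensated gE//.
    by rewrite addr_ge0// S0v.
  split.
  + by move=> t t0; rewrite XE//; exact: aX.
  + by move=> t t0; rewrite XE//; exact: iX.
  + move=> s t s0 st; rewrite (XE s s0) (XE t (le_trans s0 st)).
    exact: cX.
Unshelve. all: by end_near. Qed.
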